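(* Let $f:\mathbb{R}^n\times\mathbb{R}_+\to\mathbb{R}$ and $h:\mathbb{R}^n\times\mathbb{R}_+\to\mathbb{R}^m$ satisfy assumptions (Smoothness), (Feasibility) and (LICQ) of the context, and consider the time-varying problem: for $t\ge 0$, $\inf_{x\in\mathbb{R}^n} f(x,t)$ subject to $h(x,t)=0$. Let $V$ be a contracting basin on some finite open interval $I_0\subset\mathbb{R}_+$, and let $I=[t_0,t_1]\subset I_0$. Then, for any precision $\epsilon>0$ and any reaction time $\nu>0$, there exists $\bar\alpha>0$ such that for all $\alpha\in(0,\bar\alpha]$, $\alpha$ allows for $\epsilon$-tracking within $\nu$-time (on $I$, with respect to $V$).
   Context: Write $f_t=f(\cdot,t)$, $h_t=h(\cdot,t)$, and $\mathcal{M}(t)=\{x\in\mathbb{R}^n: h(x,t)=0\}$. Assumptions. (Smoothness) $f$ and $h$ are twice continuously differentiable in their first variable $x$, $f$ is continuous in its second variable $t$, $h$ is continuously differentiable in $t$, and $f_t$ is coercive for every $t\ge0$. (Feasibility) $\mathcal{M}(t)\neq\emptyset$ for all $t\ge 0$. (LICQ) For all $t\ge0$ and $x\in\mathcal{M}(t)$, the Jacobian of $h_t$ at $x$ has full row rank. ODE. For $\alpha>0$ consider $$\dot x(t)=-\tfrac1\alpha\,P\,\nabla_x f(x(t),t)-J^\top(JJ^\top)^{-1}h'(x(t),t),$$ where $J$ is the Jacobian of $h$ with respect to $x$ at $(x(t),t)$, $P=I_n-J^\top(JJ^\top)^{-1}J$, and $h'$ is the partial derivative of $h$ with respect to $t$.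 Let $\varphi_\alpha^t(x)$ denote the value at time $t$ of the solution of this ODE with initial condition $x(t_0)=x$. Critical points. $\mathcal{C}_0(t)$ is the set of critical points of $f_t$ on $\mathcal{M}(t)$, i.e. of $x\in\mathcal{M}(t)$ such that $\nabla_x f(x,t)\in(\ker J)^\perp$, with $J$ the Jacobian of $h_t$ at $x$. Basin. Let $I_0\subset\mathbb{R}_+$ be a finite open interval and $V\subset I_0\times\mathbb{R}^n$ open. Its slicing is $\mathrm{s}V(t)=\{x\in\mathbb{R}^n:(t,x)\in V\}$, $t\in I_0$. A correspondence $\phi:A\rightrightarrows B$ is locally bounded if every $a\in A$ has a neighbourhood $N$ such that $\phi(N)\subset D$ for some compact $D\subset B$. $V$ is a basin if $\mathrm{s}V$ is locally bounded, the correspondence $t\mapsto\overline{\mathrm{s}V(t)}$ is upper hemicontinuous, and $\overline{\mathrm{s}V(t)\cap\mathcal{M}(t)}=\overline{\mathrm{s}V(t)}\cap\mathcal{M}(t)$ for all $t\in I_0$. A basin is understood as a neighbourhood of the tracked solution, so that $\mathrm{s}V(t)\cap\mathcal{M}(t)\ne\emptyset$ for all $t\in I_0$. Set $K(t)=\overline{\mathrm{s}V(t)\cap\mathcal{M}(t)}$ (a nonempty compact set), $f^*(t)=\min_{K(t)}f_t$ and $K^*(t)=\operatorname{arg\,min}_{K(t)}f_t$. The basin $V$ is contracting if $\mathrm{s}V(t)\cap\mathcal{C}_0(t)=K^*(t)$ for all $t\in I_0$. The sets $\hat K(t)$. Define $$\hat f(t)=\tfrac12\Big(f^*(t)+\min_{\partial(\mathrm{s}V(t))\cap\mathcal{M}(t)}f_t\Big),\qquad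 \hat K(t)=\{x\in K(t): f(x,t)\le\hat f(t)\},$$ with the convention that the minimum over an empty set is $+\infty$. Tracking. For $V$ a contracting basin on $I_0$, $I=[t_0,t_1]\subset I_0$, $\epsilon>0$, $\nu>0$ and $\alpha>0$, one says that $\alpha$ allows for $\epsilon$-tracking within $\nu$-time when: (1) $\varphi_\alpha$ is defined over $I\times\hat K(t_0)$; (2) for all $t\in I$, $\varphi_\alpha^t(\hat K(t_0))\subset K(t)$; (3) for all $t\in[t_0+\nu,t_1]$ and $x\in\hat K(t_0)$, $f(\varphi_\alpha^t(x),t)-f^*(t)\le\epsilon$.
   Formalization: (Smoothness) is taken with f, h, their x-derivatives up to order two and the t-derivative of h continuous jointly in (x,t); with continuity only in each variable separately, the ODE can fail to have a solution and the claim is false. *)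

(* Defs.v *)
From HB Require Import structures.
From mathcomp Require Import all_boot all_order all_algebra.
From mathcomp Require Import all_classical all_reals all_analysis.

Set Implicit Arguments.
Unset Strict Implicit.
Unset Printing Implicit Defensive.
Import Order.TTheory GRing.Theory Num.Theory.
Import numFieldNormedType.Exports.
Local Open Scope classical_set_scope.
Local Open Scope ring_scope.

(* Points of R^n are row vectors, as in the library's ['J f p]; gradients,
   velocities and elements of kernels are manipulated as columns so that the
   matrix formulas keep their usual form.  Functions on R^n x R_+ are
   represented by total functions of t : R that are only constrained for
   0 <= t. *)

Section Smoothness.
Context {R : realType} {n : nat}.

Definition jointly_continuous {W : normedModType R} (g : 'rV[R]_n -> R -> W) :=
  {within [set p : 'rV[R]_n * R | 0 <= p.2],
    continuous (fun p => g p.1 p.2)}.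

(* Twice continuously differentiable in the first variable: as usual for
   functions of (x, t), the derivatives are continuous in the pair (x, t). *)
Definition C2_in_x {W : normedModType R} (g : 'rV[R]_n -> R -> W) :=
  forall u v : 'rV[R]_n,
  [/\ forall x (t : R), 0 <= t -> differentiable (g^~ t) x,
      forall x (t : R), 0 <= t -> differentiable ('D_u (g^~ t)) x,
      jointly_continuous (fun x t => 'D_u (g^~ t) x) &
      jointly_continuous (fun x t => 'D_v ('D_u (g^~ t)) x)].

(* At t = 0 the derivative is two-sided: a function that is C^1 in t on R_+
   (with a one-sided derivative at 0) extends affinely to t < 0, and negative
   times are otherwise irrelevant. *)
Definition C1_in_t {W : normedModType R} (g : 'rV[R]_n -> R -> W) :=
  [/\ forall x (t : R), 0 <= t -> derivable (g x) t 1,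
      jointly_continuous g &
      jointly_continuous (fun x t => 'D_1 (g x) t)].

Definition coercive (g : 'rV[R]_n -> R) :=
  forall A : R, exists B : R, forall x, B <= `|x| -> A <= g x.

End Smoothness.

Section Correspondences.
Context {T U : topologicalType}.

Definition locally_bounded_on (A : set T) (phi : T -> set U) :=
  forall a, A a ->
    exists2 D : set U, compact D & \forall b \near within A (nbhs a), phi b `<=` D.

Definition upper_hemicontinuous_on (A : set T) (phi : T -> set U) :=
  forall a, A a -> forall O : set U, open O -> phi a `<=` O ->
    \forall b \near within A (nbhs a), phi b `<=` O.

End Correspondences.

Section TimeVaryingProblem.
Context {R : realType} {n m : nat}.
Variables (f : 'rV[R]_n -> R -> R) (h : 'rV[R]_n -> R -> 'rV[R]_m).

Definition feasible_set (t : R) : set 'rV[R]_n := [set x | h x t = 0].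

(* The usual m x n Jacobian; the library's ['J] acts on row vectors and is
   its transpose. *)
Definition Jac (x : 'rV[R]_n) (t : R) : 'M[R]_(m, n) := ('J (h^~ t) x)^T.

Definition grad (x : 'rV[R]_n) (t : R) : 'cV[R]_n :=
  \col_i 'D_(delta_mx 0 i : 'rV[R]_n) (f^~ t) x.

Definition smoothness :=
  [/\ C2_in_x f, C2_in_x h, jointly_continuous f, C1_in_t h &
      forall t : R, 0 <= t -> coercive (f^~ t)].

Definition feasibility := forall t : R, 0 <= t -> feasible_set t !=set0.

Definition LICQ :=
  forall (t : R) x, 0 <= t -> feasible_set t x -> row_free (Jac x t).

Definition critical_points (t : R) : set 'rV[R]_n :=
  [set x | feasible_set t x /\
    forall v : 'cV[R]_n, Jac x t *m v = 0 -> (grad x t)^T *m v = 0].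

Definition velocity (alpha : R) (x : 'rV[R]_n) (t : R) : 'rV[R]_n :=
  let J := Jac x t in
  let Jp := J^T *m invmx (J *m J^T) in
  let P := 1%:M - Jp *m J in
  (- (alpha^-1 *: (P *m grad x t)) - Jp *m ('D_1 (h x) t)^T)^T.

(* [x] solves the ODE on [t0, t1] with x(t0) = x0.  The right-hand side only
   makes sense where J J^T is invertible, that is where J has full row rank.
   Values of [x] outside [t0, t1] are immaterial: a trajectory with one-sided
   derivatives at t0 and t1 extends affinely to one with two-sided ones. *)
Definition solution (alpha t0 t1 : R) (x0 : 'rV[R]_n) (x : R -> 'rV[R]_n) :=
  x t0 = x0 /\
  forall t : R, t0 <= t <= t1 ->
    row_free (Jac (x t) t) /\ is_derive t 1 x (velocity alpha (x t) t).

Section Basin.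
Variable V : set (R * 'rV[R]_n).

Definition Kset (t : R) : set 'rV[R]_n :=
  closure (xsection V t `&` feasible_set t).

Definition basin (a b : R) :=
  [/\ open V,
      V `<=` [set p | a < p.1 < b],
      locally_bounded_on `]a, b[%classic (xsection V),
      upper_hemicontinuous_on `]a, b[%classic
        (fun t : R => closure (xsection V t)) &
      forall t : R, a < t < b ->
        Kset t = closure (xsection V t) `&` feasible_set t /\
        xsection V t `&` feasible_set t !=set0].

(* For a basin Kset t is nonempty and compact and f_t is continuous, so this
   infimum is a minimum. *)
Definition fstar (t : R) : R := inf [set f x t | x in Kset t].

Definition Kstar (t : R) : set 'rV[R]_n :=
  [set x | Kset t x /\ forall y, Kset t y -> f x t <= f y t].

Definition contracting_basin (a b : R) :=
  basin a b /\
  forall t : R, a < t < b -> xsection V t `&` critical_points t = Kstar t.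

Definition slice_boundary (t : R) : set 'rV[R]_n :=
  closure (xsection V t) `\` (xsection V t)°.

(* The extended infimum over the compact set below is a minimum when that set
   is nonempty and +oo when it is empty. *)
Definition fhat (t : R) : \bar R :=
  (2^-1%:E * ((fstar t)%:E +
    ereal_inf [set (f x t)%:E | x in slice_boundary t `&` feasible_set t]))%E.

Definition Khat (t : R) : set 'rV[R]_n :=
  [set x | Kset t x /\ ((f x t)%:E <= fhat t)%E].

(* The flow is well defined over [t0, t1] x Khat t0 when each initial point has
   exactly one solution up to its values outside [t0, t1]. *)
Definition flow_defined (alpha t0 t1 : R) :=
  forall x0, Khat t0 x0 ->
    exists2 x, solution alpha t0 t1 x0 x &
      forall y, solution alpha t0 t1 x0 y ->
        forall t : R, t0 <= t <= t1 -> y t = x t.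

Definition allows_tracking (alpha t0 t1 eps nu : R) :=
  [/\ flow_defined alpha t0 t1,
      forall x0 x, Khat t0 x0 -> solution alpha t0 t1 x0 x ->
        forall t : R, t0 <= t <= t1 -> Kset t (x t) &
      forall x0 x, Khat t0 x0 -> solution alpha t0 t1 x0 x ->
        forall t : R, t0 + nu <= t <= t1 -> f (x t) t - fstar t <= eps].

End Basin.
End TimeVaryingProblem.

(* Main.v *)
Require Import Defs.
From HB Require Import structures.
From mathcomp Require Import all_boot all_order all_algebra.
From mathcomp Require Import all_classical all_reals all_analysis.
From mathcomp Require Import ring lra.
Import Order.TTheory GRing.Theory Num.Theory.
Import numFieldNormedType.Exports.
Local Open Scope classical_set_scope.
Local Open Scope ring_scope.

Set Implicit Arguments.
Unset Strict Implicit.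
Unset Printing Implicit Defensive.

(* On M(t) a trajectory follows the drift keeping it on M(t) plus a projected
   gradient of strength 1/alpha.  The graph K of the sets K(t) over [t0, t1] is
   compact, f* is continuous, and f - f* is bounded away from 0 on the part of
   K lying in the boundary of V, since the minimizers K*(t) are interior.  Hence
   there is a Lipschitz level l(t) > 0 that starts above f - f* on K^(t0), drops
   below eps within time nu, and stays below f - f* on the boundary part.  In a
   thin band below f - f* = l there is no critical point, so by compactness the
   projected gradient dominates there when alpha is small, and no trajectory
   crosses the band upwards.  As f and f* are merely continuous in t, the
   descent is measured with f frozen at the time of entry into the band.

   As h' is merely continuous in x, the ODE need not be Lipschitz.  Solutions
   exist by Peano's theorem applied to a cut-off vector field, and they are
   unique because x' + grad f / alpha lies in the range of J^T while J(x)(x - y)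
   is quadratic in x - y for x and y in M(t). *)

(** * Derivatives along curves *)

(** The level has to move: [Khat t0] allows gaps [f - f*] up to half the least boundary gap at time
    [t0], and this may exceed the boundary gaps of later times. A constant level would miss initial
    points or meet the boundary. The level therefore falls to a small constant while continuity
    still keeps the boundary gap above its initial value.

    Existence of solutions and invariance are entangled: the velocity makes sense only where [J] has
    full row rank, so a solution cannot be built before it is known to remain in K, while invariance
    speaks of a given curve. Hence invariance is proved for any curve that follows the velocity near
    the times it spends in K. It turns the flow of the cut-off field into a solution, and it
    confines every other solution as well, which provides the bounds that uniqueness uses. *)

Section Deriv.
Context {R : realType}.

(** The little-o form with a weak inequality holds at [s = t] too, so it can be checked separately
    on each side of [t] and glued. *)
Lemma is_derive1_near (W : normedModType R) (g : R -> W) (t : R) (d : W) :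
  is_derive t 1 g d <->
  forall e, 0 < e ->
    \forall s \near t, `|g s - g t - (s - t) *: d| <= e * `|s - t|.
Proof.
have gE h : h != 0 -> `|d - h^-1 *: (g (h%:A + t) - g t)| =
    `|h|^-1 * `|g (h + t) - g t - (h + t - t) *: d|.
  move=> h0; rewrite [h%:A]mulr1 addrK -normfV -normrZ.
  by rewrite [in RHS]scalerBr scalerA mulVf// scale1r distrC.
have cvgE : is_derive t 1 g d <->
    h^-1 *: (g (h%:A + t) - g t) @[h --> 0^'] --> d.
  split=> [[gt <-]|gd]; first exact: gt.
  by split; [exact: cvgP gd | exact: cvg_lim gd].
split=> [/cvgE/cvgrPdist_le gd e e0|gd].
  have /nbhs_ballP[r r0 rg] := gd _ e0.
  apply/nbhs_ballP; exists r => //= s st.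
  have [->|s_t] := eqVneq s t;
    first by rewrite !subrr scale0r subrr !normr0 mulr0.
  have st0 : s - t != 0 by rewrite subr_eq0.
  have := rg (s - t); rewrite gE// subrK => /(_ _ st0); rewrite mulrC.
  rewrite ler_pdivrMr ?normr_gt0//; apply; move: st.
  by rewrite /ball/= sub0r normrN distrC.
apply/cvgE/cvgrPdist_le => e e0.
have /nbhs_ballP[r r0 rg] := gd _ e0.
apply/nbhs_ballP; exists r => //= h hr h0.
rewrite gE// mulrC ler_pdivrMr ?normr_gt0//.
have := rg (h + t); rewrite addrK; apply; move: hr.
by rewrite /ball/= sub0r normrN opprD addrCA subrr addr0 normrN.
Qed.

Lemma is_derive1_continuous (W : normedModType R) (g : R -> W) (t : R) (d : W) :
  is_derive t 1 g d -> {for t, continuous g}.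
Proof.
by move=> gd; apply/differentiable_continuous/derivable1_diffP; case: gd.
Qed.

Lemma is_derive1_comp_diff (V W : normedModType R) (g : V -> W) (x : R -> V) t
  v :
  differentiable g (x t) -> is_derive t 1 x v ->
  is_derive t 1 (g \o x) ('D_v g (x t)).
Proof.
move=> dg [/derivable1_diffP dx xv].
have dgx : differentiable (g \o x) t by exact: differentiable_comp.
split; first exact/derivable1_diffP.
by rewrite -xv !deriveE// diff_comp.
Qed.

(** The half-space of positive times is open, so continuity within it is plain continuity. The times
    of the tracking interval are positive because [0 <= a < t0]. *)
Lemma jointly_continuous_at (n : nat) (W : normedModType R)
    (g : 'rV[R]_n -> R -> W) (x : 'rV[R]_n) (t : R) :
  jointly_continuous g -> 0 < t ->
  {for (x, t), continuous (fun p : 'rV[R]_n * R => g p.1 p.2)}.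
Proof.
move=> gc t0.
have opos : open [set p : 'rV[R]_n * R | 0 < p.2].
  apply: (@open_comp _ _ snd [set s : R | 0 < s]) => [[y s] _|].
    exact: cvg_snd.
  exact: open_gt.
have : {within [set p : 'rV[R]_n * R | 0 < p.2], continuous (fun p => g p.1
  p.2)}.
  by apply: continuous_subspaceW gc => -[y s] /= /ltW.
by rewrite continuous_open_subspace// => /(_ (x, t)); apply; rewrite inE.
Qed.

Lemma MVT_between (f df : R -> R) (a b : R) :
  (forall c, `|c - a| <= `|b - a| -> is_derive c 1 f (df c)) ->
  exists2 c, `|c - a| <= `|b - a| & f b - f a = df c * (b - a).
Proof.
move=> fdf; have [ab|ba] := leP a b.
- have cab c : c \in `[a, b] -> `|c - a| <= `|b - a|.
    by rewrite in_itv/= => /andP[ac cb]; rewrite !ger0_norm; lra.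
  have [c cI fE] := @MVT_segment _ f df a b ab
    (fun c cI => fdf c (cab c (subset_itv_oo_cc cI)))
    (derivable_within_continuous (fun c cI => @ex_derive _ _ _ _ _ _ _ (fdf c
      (cab c cI)))).
  by exists c => //; exact: cab.
- have cba c : c \in `[b, a] -> `|c - a| <= `|b - a|.
    by rewrite in_itv/= => /andP[bc ca]; rewrite !ler0_norm; lra.
  have [c cI fE] := @MVT_segment _ f df b a (ltW ba)
    (fun c cI => fdf c (cba c (subset_itv_oo_cc cI)))
    (derivable_within_continuous (fun c cI => @ex_derive _ _ _ _ _ _ _ (fdf c
      (cba c cI)))).
  by exists c; [exact: cba | rewrite -opprB fE; ring].
Qed.

(** The increment is split at [(x s, t)]: differentiability in space handles one part and the mean
    value theorem in time the other. Continuity of the time derivative at the single point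
    [(x t, t)] then replaces joint differentiability. *)
Lemma is_derive1_comp2 (V : normedModType R) (g : V -> R -> R) (x : R -> V) t v
  :
  (\forall q \near (x t, t), derivable (g q.1) q.2 1) ->
  {for (x t, t), continuous (fun q : V * R => 'D_1 (g q.1) q.2)} ->
  differentiable (g^~ t) (x t) -> is_derive t 1 x v ->
  is_derive t 1 (fun s => g (x s) s) ('D_v (g^~ t) (x t) + 'D_1 (g (x t)) t).
Proof.
move=> gt gtc gx xv.
apply/is_derive1_near => e e0; have e20 : 0 < e / 2 by rewrite divr_gt0.
have /is_derive1_near/(_ _ e20) xg := is_derive1_comp_diff gx xv.
have /cvgrPdist_le/(_ _ e20) gtce := gtc.
have /nbhs_ballP[r /= r0 rg] : nbhs (x t, t) [set q | derivable (g q.1) q.2 1 /\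
    `|'D_1 (g (x t)) t - 'D_1 (g q.1) q.2| <= e / 2] by exact: filterI gt gtce.
have /cvgrPdist_lt/(_ _ r0) xr := is_derive1_continuous xv.
have tr : \forall s \near t, `|t - s| < r by exact: nbhsx_ballx.
near=> s.
have xsr : `|x t - x s| < r by near: s.
have sr : `|t - s| < r by near: s.
have rgc c : `|c - t| <= `|s - t| ->
    derivable (g (x s)) c 1 /\ `|'D_1 (g (x t)) t - 'D_1 (g (x s)) c| <= e / 2.
  move=> cts; apply: (rg (x s, c)); split; rewrite -ball_normE//=.
  by rewrite distrC (le_lt_trans cts)// distrC.
have [c cts gE] := @MVT_between (g (x s)) (fun c => 'D_1 (g (x s)) c) t s
  (fun c ct => derivableP (rgc c ct).1).
have -> : g (x s) s - g (x t) t -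
    (s - t) *: ('D_v (g^~ t) (x t) + 'D_1 (g (x t)) t) =
    (g (x s) t - g (x t) t - (s - t) *: 'D_v (g^~ t) (x t)) +
    ('D_1 (g (x s)) c - 'D_1 (g (x t)) t) * (s - t).
  rewrite mulrBl -gE scalerDr; rewrite /GRing.scale/=; ring.
rewrite (le_trans (ler_normD _ _))// [e in leRHS]splitr [in leRHS]mulrDl lerD//.
  by near: s.
by rewrite normrM ler_wpM2r// distrC; have [] := rgc c cts.
Unshelve. all: by end_near. Qed.

End Deriv.

(** * Compactness and real-variable tools *)

Section Tools.
Context {R : realType}.

Lemma near_snd (X : topologicalType) (P : set R) (x : X) (t : R) :
  (\forall s \near t, P s) -> \forall q \near (x, t), P q.2.
Proof. exact: (@cvg_snd _ _ (nbhs x) (nbhs t) _ P). Qed.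

Lemma cvg_graph (X : topologicalType) (x : R -> X) (t : R) :
  {for t, continuous x} ->
  (x s, s) @[s --> t] --> (x t, t) /\ (s, x s) @[s --> t] --> (t, x t).
Proof.
move=> xc; split.
  exact: (cvg_pair (G := nbhs (x t)) (H := nbhs t) xc cvg_id).
exact: (cvg_pair (G := nbhs t) (H := nbhs (x t)) cvg_id xc).
Qed.

(** Turns a neighbourhood of the diagonal point [(p, p.2)] into a time window of radius [d] around
    the time of each [q] near [p], so that a function may be evaluated at a frozen time instead of
    the time of the point. *)
Lemma near_time (X : topologicalType) (Q : X * R -> R -> Prop) (p : X * R) :
  (\forall z \near (p, p.2), Q z.1 z.2) ->
  \forall q \near p & d \near 0^'+, forall s, `|s - q.2| <= d -> Q q s.
Proof.
move=> [[A B] /= [pA /nbhs_ballP[r /= r0 rB]] ABQ].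
have p2 : z.2 @[z --> p] --> p.2 by exact: cvg_snd.
near=> q d => s sd; apply: (ABQ (q, s)); split=> /=; first by near: q.
apply: rB; rewrite -ball_normE/=.
have d2 : d < r / 2 by near: d; apply: nbhs_right_lt; rewrite divr_gt0.
have q2 : `|p.2 - q.2| < r / 2.
  by near: q; apply: cvgr_dist_lt => //; rewrite divr_gt0.
apply: le_lt_trans (ler_distD q.2 _ _) _; rewrite [ltRHS]splitr ltrD//.
by rewrite distrC (le_lt_trans sd).
Unshelve. all: by end_near. Qed.

(** The small parameter [d] can act as a margin, as a time window or, through [d * r <= 1], as an
    inverse bound. As the conclusion is an eventual statement in [d], one choice of [d] meets
    several such estimates. *)
Lemma compact_near_within (T : topologicalType) (A : set T) (P : R -> T ->
  Prop) :
  compact A ->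
  (forall p, A p -> \forall q \near p & d \near 0^'+, A q -> P d q) ->
  \forall d \near 0^'+, forall q, A q -> P d q.
Proof.
move=> /compact_near_coveringP/near_covering_withinP Aco AP.
exact: (Aco _ _ P _ AP).
Qed.

Lemma compact_bounded_at (T : topologicalType) (A : set T) (q : T -> R) :
  compact A -> (forall p, A p -> {for p, continuous q}) ->
  exists2 C, 0 < C & forall p, A p -> `|q p| <= C.
Proof.
move=> Aco qc.
have qb : \forall d \near 0^'+, forall p, A p -> d * `|q p| <= 1.
  apply: compact_near_within => // p Ap.
  have qp : q p' @[p' --> p] --> q p := qc p Ap.
  near=> p' d => _.
  have d0 : 0 <= d by near: d; exact: nbhs_right_ge.
  have dq : d <= (`|q p| + 1)^-1.
    by near: d; apply: nbhs_right_le; rewrite invr_gt0 ltr_wpDl.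
  have qq : `|q p'| <= `|q p| + 1.
    have : `|q p - q p'| <= 1 by near: p'; apply: cvgr_dist_le.
    by have := ler_distD (q p) (q p') 0; rewrite !subr0 distrC; lra.
  apply: le_trans (ler_pM d0 (normr_ge0 _) dq qq) _.
  by rewrite mulVf// lt0r_neq0// ltr_wpDl.
near (0 : R)^'+ => d; have d0 : 0 < d by near: d; exact: nbhs_right_gt.
exists d^-1 => [|p Ap]; first by rewrite invr_gt0.
by rewrite -div1r ler_pdivlMr// mulrC; move: p Ap; near: d.
Unshelve. all: by end_near. Qed.

Lemma compact_norm_le (n : nat) (B : R) : compact [set x : 'rV[R]_n | `|x| <=
  B].
Proof.
apply: bounded_closed_compact.
  exists B; split; first exact: num_real.
  by move=> C BC y /= /le_trans; apply; exact: ltW.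
apply: (@closed_comp _ _ (fun y : 'rV[R]_n => `|y|) [set r | r <= B]).
  by move=> y _; exact: norm_continuous.
exact: closed_le.
Qed.

Lemma compact_cylinder (n : nat) (B t0 t1 : R) :
  compact [set p : 'rV[R]_n * R | `|p.1| <= B /\ t0 <= p.2 <= t1].
Proof.
have -> : [set p : 'rV[R]_n * R | `|p.1| <= B /\ t0 <= p.2 <= t1] =
    [set x : 'rV[R]_n | `|x| <= B] `*` `[t0, t1]%classic.
  by apply/seteqP; split=> p /=; rewrite in_itv.
by apply: compact_setX; [exact: compact_norm_le | exact: segment_compact].
Qed.

(** Relative to the interval because the excess along a trajectory is controlled only there, hence
    one-sidedly at the ends. *)
Definition continuous_between (p q : R) (G : R -> R) :=
  forall s, p <= s <= q -> forall e, 0 < e ->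
    \forall s' \near s, p <= s' <= q -> `|G s' - G s| < e.

Lemma last_time_le (p q A : R) (G : R -> R) : p <= q ->
  continuous_between p q G -> G p <= A ->
  exists2 s, p <= s <= q /\ G s <= A & forall s', s < s' <= q -> A < G s'.
Proof.
move=> pq Gc GpA.
pose S := [set s | p <= s <= q /\ G s <= A].
have Sp : S p by rewrite /S/= lexx.
have Sub : has_ubound S by exists q => s [/andP[]].
have supS : has_sup S by split; [exists p | exact: Sub].
have psq : p <= sup S <= q.
  by rewrite ub_le_sup//= ge_sup//; [exists p | move=> s [/andP[]]].
exists (sup S).
  split=> //; rewrite leNgt; apply/negP => AG.
  have AG0 : 0 < G (sup S) - A by rewrite subr_gt0.
  have /nbhs_ballP[r /= r0 rG] := Gc _ psq _ AG0.
  have [s [sI sA] sr] := sup_adherent r0 supS.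
  have sle : s <= sup S by apply: ub_le_sup.
  have := rG s; rewrite /ball/= ger0_norm ?subr_ge0// ltrBlDr -ltrBlDl => /(_
    sr sI).
  by rewrite ltr_norml; lra.
move=> s /andP[ss sq]; rewrite ltNge; apply/negP => GsA.
suff : s <= sup S by rewrite leNgt ss.
apply: ub_le_sup => //; split=> //; rewrite sq andbT.
by case/andP: psq => /le_trans h _; apply: h; exact: ltW.
Qed.

Lemma crossing (p q A C : R) (G : R -> R) : p <= q -> A < C ->
  continuous_between p q G -> G p <= A -> C <= G q ->
  exists s1 s2, [/\ p <= s1, s1 < s2, s2 <= q, G s1 <= A & C <= G s2 /\
    forall s, s1 < s < s2 -> A < G s < C].
Proof.
move=> pq AC Gc GpA CGq.
have [s1 [/andP[ps1 s1q] Gs1] Gs1q] := last_time_le pq Gc GpA.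
(* Reversing time and sign turns the last time at or below [- C] into the first time from [s1] on at
   or above [C]. *)
have Nc : continuous_between (- q) (- s1) (fun s => - G (- s)).
  move=> s sI e e0; have sI' : p <= - s <= q by move: sI; lra.
  have := Gc _ sI' _ e0 => /nearN; apply: filterS => s' Gs' s'I.
  by rewrite -opprD normrN Gs'//; move: s'I; lra.
have qs1 : - q <= - s1 by rewrite lerN2.
have [|s2 [s2I Gs2] Gs2q] := last_time_le (A := - C) qs1 Nc.
  by rewrite /= opprK lerN2.
move: Gs2; rewrite /= lerN2 => Gs2.
exists s1, (- s2); split=> //; try by move: s2I; lra.
  have s1s2 : s1 <= - s2 by move: s2I; lra.
  rewrite lt_neqAle s1s2 andbT; apply/eqP => s12.
  by move: Gs2; rewrite -s12 => /(le_trans) /(_ Gs1); rewrite leNgt AC.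
split=> // s /andP[s1s ss2]; rewrite Gs1q/=; last by rewrite s1s; move: s2I;
  lra.
by have := Gs2q (- s); rewrite opprK ltrN2; apply; lra.
Qed.

(** The integrating factor [expR (- C * s)] makes the product nonincreasing; it starts at 0 and is
    nonnegative, so it vanishes. *)
Lemma gronwall0 (t0 t1 C : R) (u du : R -> R) :
  (forall t, t0 <= t <= t1 ->
    [/\ is_derive t 1 u (du t), 0 <= u t & du t <= C * u t]) ->
  u t0 = 0 -> forall t, t0 <= t <= t1 -> u t = 0.
Proof.
move=> uE ut0 t /andP[t0t tt1].
pose w s := expR (- C * s) * u s.
pose dw s := expR (- C * s) * (du s - C * u s).
have wE s : t0 <= s <= t -> is_derive s 1 w (dw s).
  move=> /andP[t0s st].
  have [us _ _] := uE s ltac:(by rewrite t0s (le_trans st)).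
  apply: is_derive_eq; rewrite /dw /GRing.scale/=; ring.
have wc : {within `[t0, t], continuous w}.
  apply: derivable_within_continuous => s; rewrite in_itv/= => /wE sE.
  exact: ex_derive.
have [s sI] := MVT_segment t0t
  (fun s (sI : s \in `]t0, t[) => wE s (subset_itv_oo_cc sI)) wc.
have sI' : t0 <= s <= t1.
  by move: sI; rewrite in_itv/= => /andP[-> /le_trans ->].
have [_ _ dus] := uE s sI'.
rewrite /w ut0 mulr0 subr0 => wt; apply/eqP; rewrite eq_le.
have [_ -> _] := uE t ltac:(by rewrite t0t tt1); rewrite andbT.
rewrite -(pmulr_rle0 _ (expR_gt0 (- C * t))) wt /dw.
by rewrite mulr_le0_ge0 ?subr_ge0// mulr_ge0_le0 ?expR_ge0// subr_le0.
Qed.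

End Tools.

(** * Limits of matrices *)

Section MatrixLimits.
Context {R : realType} {T : Type} {F : set_system T} {FF : Filter F}.

Lemma cvg_mxP (m n : nat) (A : T -> 'M[R]_(m, n)) (B : 'M[R]_(m, n)) :
  A x @[x --> F] --> B <-> forall i j, A x i j @[x --> F] --> B i j.
Proof.
split=> [AB i j|AB]; first exact: (cvg_comp _ _ AB (@coord_continuous _ _ _ i j
  B)).
apply/cvgrPdist_le => e e0.
have : \forall x \near F, forall i j, `|B i j - A x i j| <= e.
  apply: filter_forall => i; apply: filter_forall => j.
  by have /cvgrPdist_le := AB i j; apply.
apply: filterS => x ABx.
rewrite /Num.Def.normr/= mx_normrE (bigmax_le _ (ltW e0))//= => -[i j] _ /=.
by rewrite !mxE.
Qed.

Lemma cvg_mulmx (m n p : nat) (A : T -> 'M[R]_(m, n)) (B : T -> 'M[R]_(n, p))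
    (A0 : 'M[R]_(m, n)) (B0 : 'M[R]_(n, p)) :
  A x @[x --> F] --> A0 -> B x @[x --> F] --> B0 ->
  A x *m B x @[x --> F] --> A0 *m B0.
Proof.
move=> /cvg_mxP AA0 /cvg_mxP BB0; apply/cvg_mxP => i j.
under eq_cvg do rewrite mxE; rewrite mxE.
apply: (@cvg_big R _ +%R 0 xpredT (@add_continuous R)) => k _.
exact: cvgM.
Qed.

Lemma cvg_trmx (m n : nat) (A : T -> 'M[R]_(m, n)) (A0 : 'M[R]_(m, n)) :
  A x @[x --> F] --> A0 -> (A x)^T @[x --> F] --> A0^T.
Proof.
move=> /cvg_mxP AA0; apply/cvg_mxP => i j.
by under eq_cvg do rewrite mxE; rewrite mxE; exact: AA0.
Qed.

Lemma cvg_det (n : nat) (A : T -> 'M[R]_n) (A0 : 'M[R]_n) :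
  A x @[x --> F] --> A0 -> \det (A x) @[x --> F] --> \det A0.
Proof.
move=> /cvg_mxP AA0.
apply: (@cvg_big R _ +%R 0 xpredT (@add_continuous R)) => s _.
apply: cvgMr.
by apply: (@cvg_big R _ *%R 1 xpredT (@mul_continuous R)) => i _; exact: AA0.
Qed.

(** Cramer's formula: adjugate and determinant are polynomial in the entries, and the determinant
    stays nonzero near the limit. *)
Lemma cvg_invmx (n : nat) (A : T -> 'M[R]_n) (A0 : 'M[R]_n) :
  A0 \in unitmx -> A x @[x --> F] --> A0 ->
  invmx (A x) @[x --> F] --> invmx A0.
Proof.
rewrite unitmxE unitfE => A0u AA0.
have dA := cvg_det AA0.
have dA0 : \forall x \near F, \det (A x) != 0.
  exact: (cvgr_neq0 _ dA A0u).
apply: (@cvg_trans _ ((\det (A x))^-1 *: \adj (A x) @[x --> F])).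
  by apply: near_eq_cvg; near=> x; rewrite /invmx unitmxE unitfE (near dA0 x).
rewrite /invmx unitmxE unitfE A0u; apply: cvgZ; first exact: cvgV.
apply/cvg_mxP => i j; under eq_cvg do rewrite mxE; rewrite mxE.
apply: cvgMr; apply: cvg_det; apply/cvg_mxP => k l.
under eq_cvg do rewrite !mxE; rewrite !mxE.
by move/cvg_mxP : AA0; apply.
Unshelve. all: by end_near. Qed.

End MatrixLimits.

(** * The projected gradient and the drift *)

Section GramMatrix.
Context {R : realType} {m n : nat}.

Lemma trmx_mul_eq0 (v : 'cV[R]_n) : v^T *m v = 0 -> v = 0.
Proof.
move=> /matrixP/(_ 0 0); rewrite !mxE => v0; apply/colP => i; rewrite mxE.
have : \sum_j v j 0 ^+ 2 == 0.
  by rewrite -[X in _ == X]v0; apply/eqP/eq_bigr => j _; rewrite mxE expr2.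
rewrite psumr_eq0 => [/allP/(_ i)|j _]; last exact: sqr_ge0.
by rewrite mem_index_enum sqrf_eq0 => /(_ isT)/eqP.
Qed.

(** If [u *m A *m A^T = 0] then [u *m A] has zero Euclidean square, so [A] and its Gram matrix have
    the same left kernel. *)
Lemma gram_unitmx (A : 'M[R]_(m, n)) : (A *m A^T \in unitmx) = row_free A.
Proof.
apply/idP/idP => [|Af].
  rewrite -row_free_unit -!kermx_eq0 => /eqP k0; apply/eqP/row_matrixP => i.
  rewrite row0; apply/eqP; rewrite -submx0 -k0.
  by apply/sub_kermxP; rewrite mulmxA -row_mul mulmx_ker row0 mul0mx.
rewrite -row_free_unit -kermx_eq0; apply/eqP/row_matrixP => i; rewrite row0.
set u := row i _.
have uAA : u *m (A *m A^T) = 0 by rewrite /u -row_mul mulmx_ker row0.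
have uA : (u *m A)^T = 0.
  apply: trmx_mul_eq0; rewrite trmxK trmx_mul mulmxA -[u *m A *m _]mulmxA uAA.
  by rewrite mul0mx.
have : u *m A = 0 by rewrite -[u *m A]trmxK uA trmx0.
by move/eqP; rewrite mulmx_free_eq0// => /eqP.
Qed.

End GramMatrix.

Section Field.
Context {R : realType} {n m : nat}.
Variables (f : 'rV[R]_n -> R -> R) (h : 'rV[R]_n -> R -> 'rV[R]_m).

Let J := Jac h.
Let Jp x t := (J x t)^T *m invmx (J x t *m (J x t)^T).

Definition pgrad (x : 'rV[R]_n) (t : R) : 'cV[R]_n :=
  (1%:M - Jp x t *m J x t) *m grad f x t.

Definition drift (x : 'rV[R]_n) (t : R) : 'cV[R]_n :=
  - (Jp x t *m ('D_1 (h x) t)^T).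

(** The Lagrange multiplier of the flow: [J^T] times it is the velocity plus [grad f / alpha]. *)
Definition multiplier (alpha : R) (x : 'rV[R]_n) (t : R) : 'cV[R]_m :=
  invmx (J x t *m (J x t)^T) *m
  (alpha^-1 *: (J x t *m grad f x t) - ('D_1 (h x) t)^T).

Lemma velocityE alpha x t :
  velocity f h alpha x t = (- (alpha^-1 *: pgrad x t) + drift x t)^T.
Proof. by []. Qed.

Lemma velocity_multiplier alpha x t : velocity f h alpha x t =
  (- (alpha^-1 *: grad f x t) + (J x t)^T *m multiplier alpha x t)^T.
Proof.
congr trmx; rewrite /multiplier mulmxBr -/(Jac h x t) -/(J x t).
rewrite mulmxBr addrA; congr (_ - _); last by rewrite mulmxA.
by rewrite mulmxBl mul1mx scalerBr opprB addrC -!scalemxAr !mulmxA.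
Qed.

Lemma Jac_pgrad x t : row_free (J x t) -> J x t *m pgrad x t = 0.
Proof.
rewrite -gram_unitmx => Ju.
by rewrite mulmxA mulmxBr mulmx1 !mulmxA mulmxV// mul1mx subrr mul0mx.
Qed.

Lemma Jac_drift x t : row_free (J x t) ->
  J x t *m drift x t = - ('D_1 (h x) t)^T.
Proof.
by rewrite -gram_unitmx => Ju; rewrite mulmxN !mulmxA mulmxV// mul1mx.
Qed.

(** [pgrad] is the orthogonal projection of the gradient on the kernel of [J], the remainder being
    in the range of [J^T]. The descent rate of [f] is thus a Euclidean square, zero only where
    [pgrad] is. *)
Lemma grad_pgrad x t : row_free (J x t) ->
  (grad f x t)^T *m pgrad x t = (pgrad x t)^T *m pgrad x t.
Proof.
move=> Jf; pose w := invmx (J x t *m (J x t)^T) *m (J x t *m grad f x t).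
have gE : grad f x t = pgrad x t + (J x t)^T *m w.
  by rewrite /pgrad mulmxBl mul1mx /w !mulmxA subrK.
rewrite {1}gE raddfD/= mulmxDl [(_ *m w)^T]trmx_mul trmxK -[w^T *m _ *m
  _]mulmxA.
by rewrite Jac_pgrad// mulmx0 addr0.
Qed.

Lemma pgrad_eq0_critical x t : feasible_set h t x -> pgrad x t = 0 ->
  critical_points f h t x.
Proof.
move=> xM; rewrite /pgrad mulmxBl mul1mx => /eqP; rewrite subr_eq0 => /eqP gE.
split=> // v Jv; have gE' : grad f x t =
    (J x t)^T *m (invmx (J x t *m (J x t)^T) *m (J x t *m grad f x t)).
  by rewrite {1}gE !mulmxA.
by rewrite gE' trmx_mul trmxK -mulmxA Jv mulmx0.
Qed.

Lemma derive_grad v x t : differentiable (f^~ t) x ->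
  'D_v (f^~ t) x = ((grad f x t)^T *m v^T) 0 0.
Proof.
move=> fx; rewrite deriveE// mxE {1}(row_sum_delta v) linear_sum.
by apply: eq_bigr => i _; rewrite linearZ/= !mxE deriveE// mulrC.
Qed.

Lemma derive_Jac v x t : differentiable (h^~ t) x ->
  'D_v (h^~ t) x = (J x t *m v^T)^T.
Proof. by move=> hx; rewrite deriveEjacobian// trmx_mul trmxK /J /Jac trmxK.
  Qed.

Hypothesis fh_smooth : smoothness f h.

Lemma differentiable_f x (t : R) : 0 <= t -> differentiable (f^~ t) x.
Proof. by case: fh_smooth => /(_ 0 0)[+ _ _ _] _ _ _ _; apply. Qed.

Lemma differentiable_h x (t : R) : 0 <= t -> differentiable (h^~ t) x.
Proof. by case: fh_smooth => _ /(_ 0 0)[+ _ _ _] _ _ _; apply. Qed.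

Lemma continuous_f x (t : R) : 0 < t ->
  {for (x, t), continuous (fun p : 'rV[R]_n * R => f p.1 p.2)}.
Proof. by case: fh_smooth => _ _ fc _ _; exact: (jointly_continuous_at fc). Qed.

Lemma continuous_h x (t : R) : 0 < t ->
  {for (x, t), continuous (fun p : 'rV[R]_n * R => h p.1 p.2)}.
Proof. by case: fh_smooth => _ _ _ [_ hc _] _;
  exact: (jointly_continuous_at hc). Qed.

Lemma continuous_dth x (t : R) : 0 < t ->
  {for (x, t), continuous (fun p : 'rV[R]_n * R => 'D_1 (h p.1) p.2)}.
Proof. by case: fh_smooth => _ _ _ [_ _ hc] _;
  exact: (jointly_continuous_at hc). Qed.

Lemma cvg_grad x (t : R) : 0 < t ->
  grad f p.1 p.2 @[p --> (x, t)] --> grad f x t.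
Proof.
move=> t0; apply/cvg_mxP => i j; under eq_cvg do rewrite mxE; rewrite mxE.
case: fh_smooth => /(_ (delta_mx 0 i) 0)[_ _ fc _] _ _ _ _.
exact: (jointly_continuous_at fc t0).
Qed.

Lemma cvg_Jac x (t : R) : 0 < t -> J p.1 p.2 @[p --> (x, t)] --> J x t.
Proof.
move=> t0; apply/cvg_mxP => i j.
have JE y s : 0 <= s -> J y s i j = 'D_(delta_mx 0 j) (h^~ s) y 0 i.
  by move=> s0; rewrite !mxE deriveE//; exact: differentiable_h.
apply: (eq_ind_r (fun l => J p.1 p.2 i j @[p --> (x, t)] --> l) _
  (JE x t (ltW t0))).
apply: (@cvg_trans _ ('D_(delta_mx 0 j) (h^~ p.2) p.1 0 i @[p --> (x, t)])).
  apply: near_eq_cvg; near=> p; apply/esym; apply: (JE p.1 p.2); near: p.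
  have : \forall s \near t, 0 <= s by exact: lt_le_nbhsr.
  exact: cvg_snd.
case: fh_smooth => _ /(_ (delta_mx 0 j) 0)[_ _ hc _] _ _ _.
exact: (cvg_comp _ _ (jointly_continuous_at hc t0)
  (@coord_continuous _ _ _ 0 i _)).
Unshelve. all: by end_near. Qed.

Section Regular.
Variables (x : 'rV[R]_n) (t : R).
Hypotheses (t0 : 0 < t) (J_free : row_free (J x t)).

Lemma cvg_gram_inv : invmx (J p.1 p.2 *m (J p.1 p.2)^T) @[p --> (x, t)] -->
  invmx (J x t *m (J x t)^T).
Proof.
apply: cvg_invmx; rewrite ?gram_unitmx//.
by apply: cvg_mulmx; [|apply: cvg_trmx]; exact: cvg_Jac.
Qed.

Let cvg_Jp : Jp p.1 p.2 @[p --> (x, t)] --> Jp x t.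
Proof.
by apply: cvg_mulmx; [apply: cvg_trmx; exact: cvg_Jac | exact: cvg_gram_inv].
Qed.

Lemma cvg_pgrad : pgrad p.1 p.2 @[p --> (x, t)] --> pgrad x t.
Proof.
apply: cvg_mulmx; last exact: cvg_grad.
apply: cvgB; first exact: cvg_cst.
by apply: cvg_mulmx; [exact: cvg_Jp | exact: cvg_Jac].
Qed.

Lemma cvg_drift : drift p.1 p.2 @[p --> (x, t)] --> drift x t.
Proof.
apply: cvgN; apply: cvg_mulmx; first exact: cvg_Jp.
by apply: cvg_trmx; exact: continuous_dth.
Qed.

Lemma cvg_multiplier alpha :
  multiplier alpha p.1 p.2 @[p --> (x, t)] --> multiplier alpha x t.
Proof.
apply: cvg_mulmx; first exact: cvg_gram_inv.
apply: cvgB; last by apply: cvg_trmx; exact: continuous_dth.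
apply: cvgZl_tmp; apply: cvg_mulmx; [exact: cvg_Jac | exact: cvg_grad].
Qed.

Lemma cvg_velocity alpha :
  velocity f h alpha p.1 p.2 @[p --> (x, t)] --> velocity f h alpha x t.
Proof.
apply: cvg_trmx; apply: cvgD; last exact: cvg_drift.
by apply: cvgN; apply: cvgZl_tmp; exact: cvg_pgrad.
Qed.

Lemma near_row_free : \forall p \near (x, t), row_free (J p.1 p.2).
Proof.
have d0 : \det (J x t *m (J x t)^T) != 0.
  by rewrite -unitfE -unitmxE gram_unitmx.
have cd : \det (J p.1 p.2 *m (J p.1 p.2)^T) @[p --> (x, t)] -->
    \det (J x t *m (J x t)^T).
  apply: cvg_det.
  by apply: cvg_mulmx; [|apply: cvg_trmx]; exact: cvg_Jac.
near=> p; rewrite -gram_unitmx unitmxE unitfE; near: p.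
exact: (cvgr_neq0 _ cd d0).
Unshelve. all: by end_near. Qed.

End Regular.

End Field.

(** * Peano's theorem *)

Lemma ultra_fmap (T U : Type) (f : T -> U) (F : set_system T) :
  UltraFilter F -> UltraFilter (f x @[x --> F]).
Proof.
move=> FU; split; first exact: fmap_proper_filter.
move=> G GF fFG; apply/seteqP; split=> [A GA|//].
have [//|FnA] := in_ultra_setVsetC (f @^-1` A) FU.
have /fFG GnA : (f x @[x --> F]) (~` A) by [].
by have /filter_ex[y []] : G (A `&` ~` A) by exact: filterI.
Qed.

Section Euler.
Context {R : realType} {n : nat}.
Variables (v : 'rV[R]_n -> R -> 'rV[R]_n) (x0 : 'rV[R]_n).

Fixpoint euler (d : R) (k : nat) : 'rV[R]_n :=
  if k is k'.+1 then euler d k' + d *: v (euler d k') (d * k'%:R) else x0.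

(** Each step contributes [d] times the deviation of the field from [w], so the polygon departs from
    uniform motion by at most [e] per unit of time. The choice [w = 0] gives the Lipschitz bound. *)
Lemma euler_increment (d e : R) (w : 'rV[R]_n) (i j : nat) :
  0 <= d -> (i <= j)%N ->
  (forall l, (i <= l <= j)%N -> `|v (euler d l) (d * l%:R) - w| <= e) ->
  `|euler d j - euler d i - (d * (j%:R - i%:R)) *: w| <=
    e * (d * (j%:R - i%:R)).
Proof.
move=> d0 /subnK <-; elim: (j - i)%N => [|k IH] vw.
  by rewrite add0n !subrr !mulr0 scale0r subrr normr0.
have -> : (k.+1 + i)%:R - i%:R = ((k + i)%:R - i%:R) + 1 :> R.
  by rewrite -[(k.+1 + i)%N]/((k + i).+1) -natr1; ring.
move: ((k + i)%:R - i%:R) IH => D IH.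
rewrite !mulrDr mulr1 scalerDl -[euler d (k.+1 + i)]/(euler d (k + i) +
  d *: v (euler d (k + i)) (d * (k + i)%:R)).
set u := v _ _; rewrite opprD [_ + d *: u - _]addrAC addrACA -scalerBr.
rewrite (le_trans (ler_normD _ _))// lerD//.
  by apply: IH => l /andP[il lk]; apply: vw;
    rewrite il/= (leq_trans lk)// addSn.
rewrite normrZ (ger0_norm d0) mulrC ler_wpM2r//.
by apply: vw; rewrite leq_addl addSn leqnSn.
Qed.

Lemma euler_incrementC (d e : R) (w : 'rV[R]_n) (i j : nat) :
  0 <= d ->
  (forall l, (minn i j <= l <= maxn i j)%N ->
    `|v (euler d l) (d * l%:R) - w| <= e) ->
  `|euler d j - euler d i - (d * (j%:R - i%:R)) *: w| <=
    e * (d * `|j%:R - i%:R|).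
Proof.
move=> d0; case: (leqP i j) => ij vw.
  by rewrite [`|j%:R - i%:R|]ger0_norm ?subr_ge0 ?ler_nat//;
    exact: euler_increment.
rewrite -normrN [`|j%:R - i%:R|]distrC.
rewrite [`|i%:R - j%:R|]ger0_norm ?subr_ge0 ?ler_nat ?(ltnW ij)//.
have -> : - (euler d j - euler d i - (d * (j%:R - i%:R)) *: w) =
    euler d i - euler d j - (d * (i%:R - j%:R)) *: w.
  by rewrite opprB addrC opprB -(opprB i%:R) mulrN scaleNr.
by apply: euler_increment => //; exact: ltnW.
Qed.

Variable M : R.
Hypothesis vM : forall x t, `|v x t| <= M.

Lemma euler_lipschitz (d : R) (i j : nat) : 0 <= d ->
  `|euler d j - euler d i| <= M * (d * `|j%:R - i%:R|).
Proof.
move=> d0; have := @euler_incrementC d M 0 i j d0.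
by rewrite scaler0 subr0; apply=> l _; rewrite subr0.
Qed.

Let step (k : nat) : R := k.+1%:R^-1.
Let index (k : nat) (t : R) : nat := Num.truncn (t / step k).
Let approx (k : nat) (t : R) := euler (step k) (index k t).

Let step_gt0 k : 0 < step k.
Proof. by rewrite invr_gt0. Qed.

Let index_itv k t : 0 <= t ->
  step k * (index k t)%:R <= t < step k * (index k t)%:R + step k.
Proof.
move=> t0; have /andP[h1 h2] := truncn_itv (divr_ge0 t0 (ltW (step_gt0 k))).
rewrite -[X in _ < _ + X]mulr1 -mulrDr natr1 ![step k * _]mulrC.
by rewrite -ler_pdivlMr// -ltr_pdivrMr// h1.
Qed.

Let index_dist k s t : 0 <= s -> 0 <= t ->
  `|step k * ((index k s)%:R - (index k t)%:R) - (s - t)| <= step k.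
Proof.
move=> /index_itv - /(_ k) sI /index_itv - /(_ k) tI.
rewrite mulrBr ler_norml; move: sI tI; lra.
Qed.

(* The Euler scheme is used as a step function: its jumps disappear in the
   pointwise limit along an ultrafilter, so that neither interpolation nor
   Ascoli's theorem is needed. *)
Lemma peano_forward : continuous (fun p : 'rV[R]_n * R => v p.1 p.2) ->
  exists2 x : R -> 'rV[R]_n, x 0 = x0 &
    forall t e, 0 <= t -> 0 < e -> exists2 r, 0 < r &
      forall s, 0 <= s -> `|s - t| < r ->
        `|x s - x t - (s - t) *: v (x t) t| <= e * `|s - t|.
Proof.
move=> vc.
have M0 : 0 <= M by rewrite (le_trans _ (vM 0 0)).
(* One ultrafilter makes the scheme converge at all times simultaneously, in place of a diagonal
   extraction of subsequences. *)
have [G [GU ooG]] := ultraFilterLemma eventually_filter.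
have step_small e : 0 < e -> \forall k \near G, step k < e.
  by move=> e0; apply: ooG; exact: near_infty_natSinv_lt (PosNum e0).
have [x xE] : exists x : R -> 'rV[R]_n,
    forall t, 0 <= t -> approx k t @[k --> G] --> x t.
  suff xt (t : R) : exists y : 'rV[R]_n, 0 <= t -> approx k t @[k --> G] --> y.
    by exists (fun t => sval (cid (xt t))) => t; exact: svalP (cid (xt t)).
  have [t0|tn0] := leP 0 t; last by exists 0.
  set A := [set y : 'rV[R]_n | `|y| <= `|x0| + M * t].
  have Aco : compact A by exact: compact_norm_le.
  have GA : G [set k | A (approx k t)].
    apply: filterE => k; rewrite /A/=.
    have := euler_lipschitz 0 (index k t) (ltW (step_gt0 k)).
    have /andP[kt _] := index_itv k t0.
    rewrite subr0 normr_nat -/(approx k t) /= => /le_trans/(_ (ler_wpM2l M0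
      kt)).
    move=> eM; rewrite -[approx k t](subrK x0) addrC.
    by rewrite (le_trans (ler_normD _ _))// lerD2l.
  move: Aco; rewrite compact_ultra.
  have GP : UltraFilter (approx k t @[k --> G]) by exact: (@ultra_fmap _ _ (fun
    k => approx k t)).
  by move=> /(_ _ GP GA)[y [_ Gy]]; exists y.
have x00 : x 0 = x0.
  apply: (@cvg_unique _ (@norm_hausdorff _ _) _ _ _ _ (xE 0 (lexx _))).
  have -> : approx^~ 0 = cst x0.
    by apply/funext => k; rewrite /approx /index mul0r truncn0.
  exact: cvg_cst.
exists x => // t e t0 e0; set w := v (x t) t.
have /cvgrPdist_le/(_ _ e0)/nbhs_ballP[r0 /= r00 vr] := vc (x t, t).
(* The radius keeps each node between [t] and [s] within [r0] of [(x t, t)]: in space, the error of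
   the scheme at [t] and [M] times the elapsed time [|s - t| + step k] cost [r0 / 4] three times.
   The 1 added to [M] bounds the time displacements by the same fractions. *)
set M1 := M + 1; have M10 : 0 < M1 by rewrite ltr_wpDl.
have r04 : 0 < r0 / 4 / M1 by rewrite !divr_gt0.
have M1r (u : R) : `|u| <= r0 / 4 / M1 -> M * `|u| <= r0 / 4 /\ `|u| <= r0 / 4.
  rewrite ler_pdivlMr// => ur; have := mulr_ge0 (normr_ge0 u) M0.
  by move: (normr_ge0 u); rewrite /M1 in ur; split; nra.
exists (r0 / 4 / M1) => // s s0 st.
(* The slack [h] absorbs the errors at finite [k]: a quarter for each of the limits at [s] and [t],
   and half for the mismatch of one step between grid times and true times. *)
apply/ler_addgt0Pr => h h0.
have w1 : 0 < e + `|w| by rewrite ltr_wpDr.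
near G => k.
have dk : step k < r0 / 4 / M1 by near: k; exact: step_small.
have dk' : step k < h / 2 / (e + `|w|) by near: k; apply: step_small;
  rewrite !divr_gt0.
have kt : `|x t - approx k t| < Num.min (r0 / 4) (h / 4).
  by near: k; apply: cvgr_dist_lt => //; [exact: xE | rewrite lt_min !divr_gt0].
have ks : `|x s - approx k s| < h / 4.
  by near: k; apply: cvgr_dist_lt => //; [exact: xE | rewrite !divr_gt0].
move: kt; rewrite lt_min => /andP[kt kt'].
have st4 := ltW st; have dk4 : `|step k| <= r0 / 4 / M1 by rewrite ger0_norm//
  ltW.
have [Mst st4'] := M1r _ st4; have [Md d4'] := M1r _ dk4.
have sE : `|step k| = step k by rewrite ger0_norm// ltW.
rewrite sE in Md d4'.
have jst := index_dist k s0 t0.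
have dj : step k * `|(index k s)%:R - (index k t)%:R| <= `|s - t| + step k.
  by rewrite -{1}sE -normrM -[X in `|X|](subrK (s - t)) (le_trans (ler_normD _
    _))// addrC lerD2l.
have near_w l : (minn (index k t) (index k s) <= l <= maxn (index k t) (index k
  s))%N ->
    `|v (euler (step k) l) (step k * l%:R) - w| <= e.
  move=> lts; rewrite distrC; apply: (vr (_, _)).
  have lt : `|(l%:R : R) - (index k t)%:R| <= `|(index k s)%:R - (index k
    t)%:R|.
    move: lts; case: (leqP (index k t)) => _ /andP[];
      rewrite -!(ler_nat R) => lt ls.
      by rewrite !ger0_norm; move: lt ls;
        clear - step_gt0 index_itv index_dist vM; lra.
    by rewrite !ler0_norm; move: lt ls;
      clear - step_gt0 index_itv index_dist vM; lra.
  have ldt : step k * `|l%:R - (index k t)%:R| <= `|s - t| + step k.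
    by rewrite (le_trans _ dj)// ler_wpM2l// ltW.
  split; rewrite -ball_normE/=.
    apply: le_lt_trans (ler_distD (approx k t) _ _) _.
    rewrite [`|approx k t - _|]distrC.
    have := @euler_lipschitz (step k) (index k t) l (ltW (step_gt0 k)).
    rewrite -/(approx k t) => /le_trans/(_ (ler_wpM2l M0 ldt)); rewrite mulrDr.
    move: (kt) (Mst) (Md) (r00); clear - step_gt0 index_itv index_dist vM; lra.
  change (`|t - step k * l%:R| < r0).
  have : `|step k * l%:R - step k * (index k t)%:R| <= r0 / 4 + r0 / 4.
    by rewrite -mulrBr normrM sE (le_trans ldt)// lerD.
  have := index_itv k t0; move: (d4') (r00).
  by rewrite ler_norml ltr_norml; clear - step_gt0 index_itv index_dist vM; lra.
have := euler_incrementC (ltW (step_gt0 k)) near_w.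
rewrite -/(approx k s) -/(approx k t); set j := _ - (index k t)%:R in jst dj *.
move=> jw.
have -> : x s - x t - (s - t) *: w =
    (x s - approx k s) + (approx k t - x t) +
    ((approx k s - approx k t - (step k * j) *: w) +
     (step k * j - (s - t)) *: w).
  by apply/rowP => i; rewrite !mxE; ring.
rewrite (le_trans (ler_normD _ _))//.
have h1 : `|x s - approx k s + (approx k t - x t)| <= h / 4 + h / 4.
  by rewrite (le_trans (ler_normD _ _))// lerD// ltW// distrC.
have h2 : `|(step k * j - (s - t)) *: w| <= step k * `|w|.
  by rewrite normrZ ler_wpM2r.
have h3 : e * (step k * `|j|) <= e * `|s - t| + step k * e.
  by rewrite [step k * e]mulrC -mulrDr ler_wpM2l// ltW.
have h4 : step k * (e + `|w|) < h / 2 by rewrite -ltr_pdivlMr.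
have := ler_normD (approx k s - approx k t - (step k * j) *: w)
  ((step k * j - (s - t)) *: w).
move: (h1) (h2) (h3) (h4) (jw); rewrite mulrDr;
  clear - step_gt0 index_itv index_dist vM; lra.
Unshelve. all: by end_near. Qed.
End Euler.

(** The forward result is applied from [t0] to the field and to its time reversal. The little-o
    estimates of the two branches combine into a two-sided derivative, also at [t0]. *)
Lemma peano (R : realType) (n : nat) (v : 'rV[R]_n -> R -> 'rV[R]_n) (M : R)
    (t0 : R) (x0 : 'rV[R]_n) :
  continuous (fun p : 'rV[R]_n * R => v p.1 p.2) ->
  (forall x t, `|v x t| <= M) ->
  exists2 x : R -> 'rV[R]_n, x t0 = x0 &
    forall t : R, is_derive t 1 x (v (x t) t).
Proof.
move=> vc vM.
pose v1 y s := v y (t0 + s); pose v2 y s := - v y (t0 - s).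
have v1c : continuous (fun p : 'rV[R]_n * R => v1 p.1 p.2).
  move=> p; apply: (@continuous2_cvg _ _ _ _ _ _ _ _ v);
    first exact: (vc (_, _)).
    exact: cvg_fst.
  by apply: cvgD; [exact: cvg_cst | exact: cvg_snd].
have v2c : continuous (fun p : 'rV[R]_n * R => v2 p.1 p.2).
  move=> p; apply: cvgN.
  apply: (@continuous2_cvg _ _ _ _ _ _ _ _ v); first exact: (vc (_, _)).
    exact: cvg_fst.
  by apply: cvgB; [exact: cvg_cst | exact: cvg_snd].
have [x1 x10 x1E] := @peano_forward _ _ v1 x0 M (fun _ _ => vM _ _) v1c.
have v2M y s : `|v2 y s| <= M by rewrite normrN.
have [x2 x20 x2E] := @peano_forward _ _ v2 x0 M v2M v2c.
pose x t := if t0 <= t then x1 (t - t0) else x2 (t0 - t).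
have xE1 t : t0 <= t -> x t = x1 (t - t0) by rewrite /x => ->.
have xE2 t : t <= t0 -> x t = x2 (t0 - t).
  move=> tt0; rewrite /x; have [t0t|//] := leP t0 t;
    have -> : t = t0 by apply/eqP; rewrite eq_le tt0.
  by rewrite subrr x10 x20.
exists x => [|t]; first by rewrite xE1// subrr.
apply/is_derive1_near => e e0; apply/nbhs_ballP.
suff [[r1 r10 r1E] [r2 r20 r2E]] :
    (exists2 r, 0 < r & forall s, t0 <= s -> `|t - s| < r ->
      `|x s - x t - (s - t) *: v (x t) t| <= e * `|s - t|) /\
    (exists2 r, 0 < r & forall s, s <= t0 -> `|t - s| < r ->
      `|x s - x t - (s - t) *: v (x t) t| <= e * `|s - t|).
  exists (Num.min r1 r2) => [|s]; first by rewrite /= lt_min r10.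
  rewrite /ball/= lt_min => /andP[st1 st2].
  by have [t0s|/ltW st0] := leP t0 s; [exact: r1E | exact: r2E].
split.
- have [t0t|tt0] := leP t0 t; last first.
    exists (t0 - t) => [|s t0s]; first by rewrite subr_gt0.
    by rewrite ler0_norm; lra.
  have [r r0 rE] := x1E (t - t0) e ltac:(lra) e0; exists r => // s t0s st.
  have := rE (s - t0) ltac:(lra); rewrite -(xE1 s)// -(xE1 t)// /v1 subrKC.
  have -> : s - t0 - (t - t0) = s - t by ring.
  by apply; rewrite distrC.
- have [tt0|t0t] := leP t t0; last first.
    exists (t - t0) => [|s st0]; first by rewrite subr_gt0.
    by rewrite ger0_norm; lra.
  have [r r0 rE] := x2E (t0 - t) e ltac:(lra) e0; exists r => // s st0 st.
  have := rE (t0 - s) ltac:(lra); rewrite -(xE2 s)// -(xE2 t)// /v2 subKr.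
  have -> : t0 - s - (t0 - t) = - (s - t) by ring.
  by rewrite scaleNr scalerN opprK normrN; apply; rewrite distrC.
Qed.

(** * Differentiation through a continuous linear functional *)

Section LinearDerive.
Context {R : realType} {W : normedModType R}.
Variable pi : {linear W -> R}.
Hypothesis pi_cont : continuous pi.

Lemma is_derive_linear (V : normedModType R) (k : V -> W) (z v : V) (d : W) :
  is_derive z v k d -> is_derive z v (pi \o k) (pi d).
Proof.
move=> [kz kd].
have kc : (fun r => r^-1 *: ((pi \o k \o shift z) (r *: v) - (pi \o k) z))
    @ 0^' --> pi d.
  have -> : (fun r => r^-1 *: ((pi \o k \o shift z) (r *: v) - (pi \o k) z)) =
      pi \o (fun r => r^-1 *: ((k \o shift z) (r *: v) - k z)).
    by apply/funext => r /=; rewrite linearZ_LR (raddfB pi).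
  have kzd : (fun r => r^-1 *: ((k \o shift z) (r *: v) - k z)) @ 0^' --> d.
    by rewrite -kd; exact: kz.
  by apply: continuous_cvg; [exact: pi_cont | exact: kzd].
by split; [exact: cvgP kc | exact: cvg_lim kc].
Qed.

(** The mean value theorem in time is scalar, so a vector-valued [g] is differentiated through [pi],
    in practice a coordinate. *)
Lemma is_derive1_comp2_linear (V : normedModType R) (g : V -> R -> W) (x : R ->
  V) (t : R) (v : V) :
  (\forall q \near (x t, t), derivable (g q.1) q.2 1) ->
  {for (x t, t), continuous (fun q : V * R => 'D_1 (g q.1) q.2)} ->
  differentiable (g^~ t) (x t) -> is_derive t 1 x v ->
  is_derive t 1 (fun s => pi (g (x s) s))
    (pi ('D_v (g^~ t) (x t) + 'D_1 (g (x t)) t)).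
Proof.
move=> gt gtc gx xv; rewrite linearD.
have piD1 y (s : R) : derivable (g y) s 1 ->
    is_derive s 1 (fun r => pi (g y r)) (pi ('D_1 (g y) s)).
  by move=> gy; exact: (is_derive_linear (derivableP gy)).
have gxt : derivable (g (x t)) t 1 := nbhs_singleton gt.
have pix : is_derive (x t) v (fun y => pi (g y t)) (pi ('D_v (g^~ t) (x t))).
  by apply: is_derive_linear; apply/derivableP; exact: diff_derivable.
rewrite -(@derive_val _ _ _ _ _ _ _ pix) -(@derive_val _ _ _ _ _ _ _ (piD1 _ _
  gxt)).
apply: (@is_derive1_comp2 _ _ (fun y s => pi (g y s))) => //.
- near=> q.
  have /piD1[] : derivable (g q.1) q.2 1 by near: q.
  by [].
- rewrite /prop_for /continuous_at.
  have -> : 'D_1 (fun s => pi (g (x t, t).1 s)) (x t, t).2 = pi ('D_1 (g (x t))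
    t).
    exact: (@derive_val _ _ _ _ _ _ _ (piD1 _ _ gxt)).
  apply: (@cvg_trans _ (pi ('D_1 (g q.1) q.2) @[q --> (x t, t)])).
    apply: near_eq_cvg; near=> q; apply/esym.
    have gq : derivable (g q.1) q.2 1 by near: q.
    exact: (@derive_val _ _ _ _ _ _ _ (piD1 _ _ gq)).
  have gtc' : 'D_1 (g q.1) q.2 @[q --> (x t, t)] --> 'D_1 (g (x t)) t := gtc.
  apply: (cvg_comp _ _ gtc'). exact: pi_cont.
- by apply: (differentiable_comp gx); exact: linear_differentiable.
Unshelve. all: by end_near. Qed.

End LinearDerive.

(** * Second-order estimates and uniqueness *)

Lemma uniform_constant (R : realType) (k : nat) (P : 'I_k -> R -> Prop) :
  (forall i C C', C <= C' -> P i C -> P i C') ->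
  (forall i, exists2 C, 0 < C & P i C) -> exists2 C, 0 < C & forall i, P i C.
Proof.
move=> Pmono PE; pose C i := sval (cid2 (PE i)).
have C0 i : 0 < C i by rewrite /C; case: cid2.
have PC i : P i (C i) by rewrite /C; case: cid2.
(* The sum stands in for a maximum; the 1 keeps it positive when [k = 0]. *)
exists (\sum_i C i + 1) => [|i].
  by rewrite ltr_wpDl// sumr_ge0// => i _; exact: ltW.
apply: Pmono (PC i); rewrite (bigD1 i)//= -addrA lerDl addr_ge0// sumr_ge0//.
by move=> j _; exact: ltW.
Qed.

Section SecondOrder.
Context {R : realType} {n : nat} {W : normedModType R}.
Variables (g : 'rV[R]_n -> R -> W) (pi : {linear W -> R}).
Hypotheses (g_C2 : C2_in_x g) (pi_cont : continuous pi).

Lemma is_derive1_segment (x y : 'rV[R]_n) (s : R) :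
  is_derive s 1 (fun s => x + s *: (y - x)) (y - x).
Proof.
apply/is_derive1_near => e e0; near=> r.
rewrite opprD addrACA subrr add0r -scalerBl subrr normr0.
by rewrite mulr_ge0// ltW.
Unshelve. all: by end_near. Qed.

Lemma segment_norm_le (B : R) (x y : 'rV[R]_n) (s : R) :
  `|x| <= B -> `|y| <= B -> 0 <= s <= 1 -> `|x + s *: (y - x)| <= B.
Proof.
move=> xB yB /andP[s0 s1].
have -> : x + s *: (y - x) = (1 - s) *: x + s *: y.
  by rewrite scalerBl scalerBr scale1r addrCA addrC.
rewrite (le_trans (ler_normD _ _))// !normrZ !ger0_norm ?subr_ge0//.
by nra.
Qed.

Lemma mean_value_segment (k : 'rV[R]_n -> W) (x y : 'rV[R]_n) :
  (forall z, differentiable k z) ->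
  exists2 s, 0 <= s <= 1 &
    pi (k y) - pi (k x) = pi ('D_(y - x) k (x + s *: (y - x))).
Proof.
move=> dk.
have dseg (s : R) : is_derive s 1 (pi \o (k \o (fun s => x + s *: (y - x))))
    (pi ('D_(y - x) k (x + s *: (y - x)))).
  apply: is_derive_linear => //; apply: (@is_derive1_comp_diff _ _ _ k) => //.
  exact: is_derive1_segment.
have segc : {within `[0, 1], continuous (pi \o (k \o (fun s : R => x + s *: (y
  - x))))}.
  by apply: derivable_within_continuous => s _; case: (dseg s).
have [s sI] := MVT_segment ler01 (fun s _ => dseg s) segc.
rewrite /= scale0r addr0 scale1r subrKC subr0 mulr1 => ->.
by exists s; rewrite // -in_itv.
Qed.

Lemma derive_sum_delta (k : 'rV[R]_n -> W) (v z : 'rV[R]_n) :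
  differentiable k z ->
  pi ('D_v k z) = \sum_i v 0 i * pi ('D_(delta_mx 0 i : 'rV[R]_n) k z).
Proof.
move=> dk; rewrite deriveE// {1}(row_sum_delta v) linear_sum (linear_sum pi).
by apply: eq_bigr => i _; rewrite !linearZ/= deriveE.
Qed.

Lemma coord_norm_le (v : 'rV[R]_n) i : `|v 0 i| <= `|v|.
Proof.
rewrite [leRHS]/Num.Def.normr/= mx_normrE.
exact: (le_bigmax _ (fun ij : 'I_1 * 'I_n => `|v ij.1 ij.2|) (0, i)).
Qed.

Lemma sum_coord_le (v : 'rV[R]_n) (c : 'I_n -> R) (C : R) :
  (forall i, `|c i| <= C) -> `|\sum_i v 0 i * c i| <= n%:R * C * `|v|.
Proof.
move=> cC; apply: le_trans (ler_norm_sum _ _ _) _.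
rewrite -mulrA mulr_natl -[in n in _ *+ n](card_ord n) -sumr_const.
apply: ler_sum => i _; rewrite normrM mulrC.
by apply: ler_pM => //; exact: coord_norm_le.
Qed.

Variables (B t0 t1 : R).
Hypothesis t0_gt0 : 0 < t0.

(** The second derivatives are bounded on the compact cylinder, whose slices are convex, so the mean
    value theorem applies along the segment from [x] to [y]. *)
Lemma derive_lipschitz (u : 'rV[R]_n) : exists2 C, 0 < C &
  forall t x y, t0 <= t <= t1 -> `|x| <= B -> `|y| <= B ->
    `|pi ('D_u (g^~ t) y) - pi ('D_u (g^~ t) x)| <= C * `|y - x|.
Proof.
pose q i (p : 'rV[R]_n * R) :=
  pi ('D_(delta_mx 0 i : 'rV[R]_n) ('D_u (g^~ p.2)) p.1).
have [C C0 qC] : exists2 C, 0 < C & forall i (p : 'rV[R]_n * R),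
    `|p.1| <= B /\ t0 <= p.2 <= t1 -> `|q i p| <= C.
  apply: uniform_constant => [i C C' CC' qC p /qC/le_trans|i]; first exact.
  apply: (compact_bounded_at (@compact_cylinder R n B t0 t1)).
  move=> [x t] [_ /andP[/(lt_le_trans t0_gt0) tpos _]].
  have [_ _ _ Duc] := g_C2 u (delta_mx 0 i).
  apply: continuous_comp; last exact: pi_cont.
  exact: (jointly_continuous_at Duc tpos).
exists (n%:R * C + 1) => [|t x y tI xB yB].
  by rewrite ltr_wpDl// mulr_ge0// ltW.
have tpos : 0 <= t by case/andP: tI => /(lt_le_trans t0_gt0)/ltW.
have [_ dDu _ _] := g_C2 u 0.
have [s sI ->] := @mean_value_segment _ x y (fun z => dDu z t tpos).
set z := x + _; rewrite derive_sum_delta; last exact: dDu.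
apply: (@le_trans _ _ (n%:R * C * `|y - x|)); last first.
  by rewrite ler_wpM2r// lerDl.
apply: sum_coord_le => i.
have zB : `|z| <= B by exact: segment_norm_le.
exact: (qC i (z, t)).
Qed.

(** The increment is a derivative at an intermediate point; moving that point back to [x] costs a
    Lipschitz factor, whence the square. *)
Lemma taylor2 : exists2 C, 0 < C &
  forall t x y, t0 <= t <= t1 -> `|x| <= B -> `|y| <= B ->
    `|pi (g y t) - pi (g x t) - pi ('D_(y - x) (g^~ t) x)| <= C * `|y - x| ^+ 2.
Proof.
have [C C0 CE] := uniform_constant (fun i C C' CC' CE t x y tI xB yB =>
    le_trans (CE t x y tI xB yB) (ler_wpM2r (normr_ge0 (y - x)) CC'))
  (fun i => derive_lipschitz (delta_mx 0 i)).
exists (n%:R * C + 1) => [|t x y tI xB yB].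
  by rewrite ltr_wpDl// mulr_ge0// ltW.
have tpos : 0 <= t by case/andP: tI => /(lt_le_trans t0_gt0)/ltW.
have [dg _ _ _] := g_C2 0 0.
have [s sI ->] := @mean_value_segment _ x y (fun z => dg z t tpos).
set z := x + _; rewrite !derive_sum_delta; try exact: dg.
rewrite -sumrB; under eq_bigr do rewrite -mulrBr.
apply: (@le_trans _ _ (n%:R * (C * `|y - x|) * `|y - x|)); last first.
  by rewrite mulrA -mulrA -expr2 ler_wpM2r// ?sqr_ge0// lerDl.
apply: sum_coord_le => i.
have zB : `|z| <= B by exact: segment_norm_le.
apply: (le_trans (CE i t x z tI xB zB)).
rewrite ler_wpM2l ?(ltW C0)// /z addrC addKr normrZ ler_piMl//.
by case/andP: sI => s0 s1; rewrite ger0_norm.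
Qed.

End SecondOrder.

Section Coordinate.
Context {R : realType} {n : nat}.

Definition row_coord (i : 'I_n) (v : 'rV[R]_n) : R := v 0 i.

Lemma row_coord_is_linear i : linear (row_coord i).
Proof. by move=> a u v; rewrite /row_coord !mxE. Qed.

HB.instance Definition _ i :=
  GRing.isLinear.Build R 'rV[R]_n R _ (row_coord i) (row_coord_is_linear i).

Lemma continuous_row_coord i : continuous (row_coord i).
Proof. exact: coord_continuous. Qed.

End Coordinate.

Section Uniqueness.
Context {R : realType} {n m : nat}.
Variables (f : 'rV[R]_n -> R -> R) (h : 'rV[R]_n -> R -> 'rV[R]_m).
Hypothesis fh_smooth : smoothness f h.

Lemma velocity_coord alpha x t i : velocity f h alpha x t 0 i =
  - (alpha^-1 * 'D_(delta_mx 0 i : 'rV[R]_n) (f^~ t) x) +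
  \sum_k Jac h x t k i * multiplier f h alpha x t k 0.
Proof.
rewrite velocity_multiplier !mxE; congr (_ + _).
by apply: eq_bigr => k _; rewrite !mxE.
Qed.

(** Pairing with [w] moves [J^T] across: the multiplier meets only [J w], which is of second order
    when [w] joins two feasible points. *)
Lemma sum_velocity alpha (w x : 'rV[R]_n) (t : R) : 0 <= t ->
  \sum_i w 0 i * velocity f h alpha x t 0 i =
  - (alpha^-1 * \sum_i w 0 i * 'D_(delta_mx 0 i : 'rV[R]_n) (f^~ t) x) +
  \sum_k multiplier f h alpha x t k 0 * row_coord k ('D_w (h^~ t) x).
Proof.
move=> t0; rewrite mulr_sumr -sumrN.
rewrite (eq_bigr (fun i => - (alpha^-1 * (w 0 i * 'D_(delta_mx 0 i) (f^~ t) x))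
  +
  \sum_k w 0 i * (Jac h x t k i * multiplier f h alpha x t k 0))); last first.
  by move=> i _; rewrite velocity_coord mulrDr mulr_sumr mulrN mulrCA.
rewrite big_split/= exchange_big/=; congr (_ + _); apply: eq_bigr => k _.
rewrite (derive_Jac _ (differentiable_h fh_smooth x t0)) /row_coord.
rewrite [(_ *m _)^T _ _]mxE [(_ *m _) _ _]mxE mulr_sumr.
by apply: eq_bigr => i _; rewrite [w^T _ _]mxE; ring.
Qed.

(** Links the sup norm, in which the estimates are stated, to the Euclidean energy, which can be
    differentiated. *)
Lemma norm_le_sum_sqr (w : 'rV[R]_n) : `|w| ^+ 2 <= \sum_i w 0 i ^+ 2.
Proof.
have [->|] := eqVneq `|w| 0; first by rewrite expr0n/= sumr_ge0// => i _;
  exact: sqr_ge0.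
move=> /mx_norm_neq0[[j i] /= wE]; rewrite [`|w|]wE ord1 real_normK ?num_real//.
by rewrite (bigD1 i)//= lerDl sumr_ge0// => k _; exact: sqr_ge0.
Qed.

Variables (alpha t0 t1 B M : R).
Hypothesis t0_gt0 : 0 < t0.

(** Confinement to the compact graph of the sets [K(t)] provides these bounds; they make the
    constants of the energy estimate uniform in time. *)
Definition bounded_solution (x : R -> 'rV[R]_n) := forall t : R, t0 <= t <= t1
  ->
  [/\ `|x t| <= B, h (x t) t = 0,
      forall k, `|multiplier f h alpha (x t) t k 0| <= M &
      is_derive t 1 x (velocity f h alpha (x t) t)].

Let norm_bound (p q a b A B' U : R) : `|p - q| <= A -> `|a| <= B' ->
  `|b| <= B' -> A + 2 * B' <= U -> 2 * (- p + a - (- q + b)) <= 2 * U.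
Proof. by rewrite !ler_norml; lra. Qed.

(* Both points lie on the constraint set, so a Taylor expansion makes
   [J(x) (x - y)] quadratic in [x - y]: the multiplier terms, which are merely
   continuous in [x], do not spoil the energy estimate. *)
Lemma bounded_solution_unique (x y : R -> 'rV[R]_n) :
  bounded_solution x -> bounded_solution y -> x t0 = y t0 ->
  forall t, t0 <= t <= t1 -> x t = y t.
Proof.
move=> xS yS xy0.
have [fC hC _ _ _] := fh_smooth.
have [Cf Cf0 CfE] := uniform_constant (fun i C C' CC' CE t x y tI xB yB =>
    le_trans (CE t x y tI xB yB) (ler_wpM2r (normr_ge0 (y - x)) CC'))
  (fun i => derive_lipschitz (pi := idfun) fC (fun x => @cvg_id _ (nbhs x)) B t1
     t0_gt0 (delta_mx 0 i)).
have [Ch Ch0 ChE] := uniform_constant (fun i C C' CC' CE t x y tI xB yB =>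
    le_trans (CE t x y tI xB yB) (ler_wpM2r (sqr_ge0 `|y - x|) CC'))
  (fun k => taylor2 hC (@continuous_row_coord _ _ k) B t1 t0_gt0).
pose w t := x t - y t.
pose dw t := velocity f h alpha (x t) t - velocity f h alpha (y t) t.
pose u (t : R) := \sum_i (w t) 0 i ^+ 2.
pose du t := 2 * \sum_i w t 0 i * dw t 0 i.
have u_derive t : t0 <= t <= t1 -> is_derive t 1 u (du t).
  move=> tI; have [_ _ _ xt] := xS t tI; have [_ _ _ yt] := yS t tI.
  have wt : is_derive t 1 w (dw t) by exact: (is_deriveB xt yt).
  have wti i : is_derive t 1 (fun s => w s 0 i) (dw t 0 i).
    exact: (is_derive_linear (@continuous_row_coord _ _ i) wt).
  have uE : u = \sum_i (fun s => w s 0 i) ^+ 2.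
    by apply/funext => s; rewrite fct_sumE; apply: eq_bigr => i _;
      rewrite expr2.
  rewrite uE; apply: is_derive_eq.
  rewrite /du mulr_sumr; apply: eq_bigr => i _.
  by rewrite expr1 mulr_natl -mulr_natl /GRing.scale/= mulrA.
(* The first term comes from the Lipschitz bound on the gradients, the second from the multiplier
   terms at [x] and at [y], one Taylor bound per constraint. As [M] is an arbitrary real, [|M|]
   replaces it. *)
pose C := `|alpha^-1| * (n%:R * Cf) + 2 * (m%:R * (`|M| * Ch)).
have C0 : 0 <= C by rewrite addr_ge0// !mulr_ge0// ltW.
have sum_mult (mu : 'I_m -> R) (d : 'rV[R]_m) r : (forall k, `|mu k| <= M) ->
    (forall k, `|row_coord k d| <= Ch * r) ->
    `|\sum_k mu k * row_coord k d| <= m%:R * (`|M| * Ch) * r.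
  move=> muM dr; apply: le_trans (ler_norm_sum _ _ _) _.
  rewrite -!mulrA mulr_natl -[in m in _ *+ m](card_ord m) -sumr_const.
  apply: ler_sum => k _; rewrite normrM; apply: ler_pM => //.
  by rewrite (le_trans (muM k))// ler_norm.
have uC t : t0 <= t <= t1 -> du t <= 2 * C * u t.
  move=> tI; have t_ge0 : 0 <= t by case/andP: tI => /(lt_le_trans t0_gt0)/ltW.
  have [xB hx xM _] := xS t tI; have [yB hy yM _] := yS t tI.
  have dwE : \sum_i w t 0 i * dw t 0 i =
      \sum_i w t 0 i * velocity f h alpha (x t) t 0 i -
      \sum_i w t 0 i * velocity f h alpha (y t) t 0 i.
    rewrite -sumrB; apply: eq_bigr => i _.
    by rewrite -mulrBr; congr (_ * _); exact: (linearB (row_coord i)).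
  pose Fx := \sum_i w t 0 i * 'D_(delta_mx 0 i : 'rV[R]_n) (f^~ t) (x t).
  pose Fy := \sum_i w t 0 i * 'D_(delta_mx 0 i : 'rV[R]_n) (f^~ t) (y t).
  pose Mx := \sum_k multiplier f h alpha (x t) t k 0 * row_coord k ('D_(w t)
    (h^~ t) (x t)).
  pose My := \sum_k multiplier f h alpha (y t) t k 0 * row_coord k ('D_(w t)
    (h^~ t) (y t)).
  have -> : du t = 2 * (- (alpha^-1 * Fx) + Mx - (- (alpha^-1 * Fy) + My)).
    apply: (congr1 (fun a => 2 * a)); apply: (etrans dwE).
    exact: (congr2 (fun a b => a - b) (sum_velocity alpha (w t) (x t) t_ge0)
      (sum_velocity alpha (w t) (y t) t_ge0)).
  have xy2 : `|y t - x t| ^+ 2 = `|w t| ^+ 2 by rewrite distrC.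
  have hMx : `|Mx| <= m%:R * (`|M| * Ch) * `|w t| ^+ 2.
    apply: sum_mult => // k; have := ChE k t (x t) (y t) tI xB yB.
    rewrite hx hy xy2 linear0 subrr sub0r normrN.
    rewrite -[y t - x t]opprB deriveE; last exact: (differentiable_h fh_smooth).
    rewrite linearN/= linearN normrN -deriveE//.
    exact: (differentiable_h fh_smooth).
  have hMy : `|My| <= m%:R * (`|M| * Ch) * `|w t| ^+ 2.
    apply: sum_mult => // k; have := ChE k t (y t) (x t) tI yB xB.
    by rewrite hx hy linear0 subrr sub0r normrN.
  have hF : `|Fx - Fy| <= n%:R * Cf * `|w t| ^+ 2.
    rewrite /Fx /Fy -sumrB; under eq_bigr do rewrite -mulrBr.
    rewrite expr2 mulrA -(mulrA n%:R); apply: sum_coord_le => i.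
    by have := CfE i t (y t) (x t) tI yB xB.
  have hA : `|alpha^-1 * (Fx - Fy)| <= `|alpha^-1| * (n%:R * Cf) * `|w t| ^+ 2.
    by rewrite normrM -mulrA ler_wpM2l.
  have wu : C * `|w t| ^+ 2 <= C * u t by rewrite ler_wpM2l// norm_le_sum_sqr.
  rewrite mulrBr in hA; rewrite -mulrA; apply: (norm_bound hA hMx hMy).
  by apply: le_trans wu;
    rewrite /C [in leRHS]mulrDl -[2 * _ * `|w t| ^+ 2]mulrA.
have uS t : t0 <= t <= t1 -> [/\ is_derive t 1 u (du t), 0 <= u t & du t <= 2 *
  C * u t].
  move=> tI; split; [exact: u_derive | | exact: uC].
  by apply: sumr_ge0 => i _; exact: sqr_ge0.
have ut0 : u t0 = 0.
  by rewrite /u /w xy0 subrr big1// => i _; rewrite mxE expr0n.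
move=> t tI; have ut := gronwall0 uS ut0 tI.
apply/eqP; rewrite -subr_eq0 -/(w t) -normr_eq0 -sqrf_eq0 eq_le sqr_ge0 andbT.
by rewrite -ut norm_le_sum_sqr.
Qed.

End Uniqueness.

(** * Localizing the vector field near a compact set *)

Lemma clamp_lipschitz (R : realDomainType) (s r : R) :
  `|Num.max 0 (Num.min 1 s) - Num.max 0 (Num.min 1 r)| <= `|s - r|.
Proof.
have := ler_norm (s - r); have := ler_norm (r - s); rewrite (distrC r s).
have := normr_ge0 (s - r); rewrite ler_norml /Num.max /Num.min.
move: `|s - r| => d; case: (ltP 1 s) => ?; case: (ltP 1 r) => ?.
all: case: (ltP 0 s) => ?; case: (ltP 0 r) => ?; rewrite ?ltr01 => *.
all: by apply/andP; split; lra.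
Qed.

Section Cutoff.
Context {R : realType} {X E : normedModType R}.
Variables (A : set X) (w : X -> E).
Hypotheses (A_compact : compact A)
  (w_continuous : forall p, A p -> \forall q \near p, {for q, continuous w}).

Let dist (q : X) := inf [set `|q - p| | p in A].

Let dist_has_inf q : A !=set0 -> has_inf [set `|q - p| | p in A].
Proof.
move=> [p Ap]; split; first by exists `|q - p|, p.
by exists 0 => _ [r _ <-].
Qed.

Let dist_le q p : A p -> dist q <= `|q - p|.
Proof.
move=> Ap; apply: ge_inf; last by exists p.
by have [] := dist_has_inf q (ex_intro _ p Ap).
Qed.

Let dist_lt q r : A !=set0 -> dist q < r -> exists2 p, A p & `|q - p| < r.
Proof.
move=> A0 /(inf_lt (dist_has_inf q A0).1)[_ [p Ap <-] qp].
by exists p.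
Qed.

Let dist_lipschitz q q' : A !=set0 -> dist q <= `|q - q'| + dist q'.
Proof.
move=> A0; rewrite -lerBlDl; apply: lb_le_inf => [|_ [p Ap <-]].
  by have [] := dist_has_inf q' A0.
rewrite lerBlDl (le_trans (dist_le q Ap))//; exact: ler_distD.
Qed.

Let clamp (s : R) : R := Num.max 0 (Num.min 1 s).

(** A uniform tube around [A]: [d] is both its width and the inverse of the bound on [w] in it. *)
Lemma compact_regular : \forall d \near 0^'+, forall p, A p ->
  forall q, `|q - p| < d -> {for q, continuous w} /\ d * `|w q| <= 1.
Proof.
apply: compact_near_within => // p Ap.
have wp := w_continuous Ap.
have wpc : w q @[q --> p] --> w p := nbhs_singleton wp.
have wpb : \forall q \near p, `|w p - w q| <= 1.
  by move/cvgrPdist_le : wpc; apply.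
have /nbhs_ballP[r /= r0 rE] : nbhs p [set q | {for q, continuous w} /\ `|w p -
  w q| <= 1].
  exact: filterI.
near=> p' d => _ q qp'.
have d0 : 0 <= d by near: d; exact: nbhs_right_ge.
have dw : d <= (`|w p| + 1)^-1.
  by near: d; apply: nbhs_right_le; rewrite invr_gt0 ltr_wpDl.
have dr : d < r / 2 by near: d; apply: nbhs_right_lt; rewrite divr_gt0.
have pp' : `|p - p'| < r / 2.
  by near: p'; have /cvgrPdist_lt := @cvg_id _ (nbhs p); apply;
    rewrite divr_gt0.
have [|wq wpq] := rE q.
  rewrite -ball_normE/= (le_lt_trans (ler_distD p' _ _))// [ltRHS]splitr ltrD//.
  by rewrite distrC (lt_trans qp').
split=> //; apply: (@le_trans _ _ ((`|w p| + 1)^-1 * (`|w p| + 1))).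
  apply: ler_pM => //.
  by have := ler_distD (w p) (w q) 0; rewrite !subr0 distrC; lra.
by rewrite mulVf// lt0r_neq0// ltr_wpDl.
Unshelve. all: by end_near. Qed.

(* [w] is multiplied by a piecewise affine function of the distance to [A]. *)
Lemma cutoff : exists v : X -> E, exists M : R,
  [/\ continuous v, forall q, `|v q| <= M &
      forall p, A p -> \forall q \near p, v q = w q].
Proof.
(* The infimum defining [dist] carries no information over the empty set. *)
have [->|A0] := eqVneq A set0.
  by exists (cst 0), 0; split=> [q|q|//]; [exact: cvg_cst | rewrite normr0].
have {}A0 : A !=set0 by exact/set0P.
near (0 : R)^'+ => d; have d0 : 0 < d by near: d; exact: nbhs_right_gt.
have dE : forall p, A p ->
  forall q, `|q - p| < d -> {for q, continuous w} /\ d * `|w q| <= 1.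
  by near: d; exact: compact_regular.
(* Equal to 1 up to distance [d / 4] and to 0 from [d / 2] on, well inside the tube of width [d]:
   the product with [w] is continuous whatever [w] is outside the tube. *)
pose chi q := clamp (2 - 4 / d * dist q).
have chi_ge0 q : 0 <= chi q by rewrite le_max lexx.
have chi_le1 q : chi q <= 1 by rewrite ge_max ler01 ge_min lexx.
have chi1 q : dist q <= d / 4 -> chi q = 1.
  move=> qd; have : 4 / d * dist q <= 1.
    by rewrite mulrC mulrA ler_pdivrMr// mul1r -ler_pdivlMr.
  move=> h; rewrite /chi /clamp min_l; last by lra.
  by rewrite max_r.
have chi0 q : d / 2 <= dist q -> chi q = 0.
  move=> qd; have : 2 <= 4 / d * dist q.
    by rewrite mulrC mulrA ler_pdivlMr//; lra.
  move=> h; rewrite /chi /clamp max_l// ge_min.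
  by apply/orP; right; lra.
have chic q : chi q' @[q' --> q] --> chi q.
  apply/cvgrPdist_le => e e0; near=> q'.
  apply: le_trans (clamp_lipschitz _ _) _.
  have -> : 2 - 4 / d * dist q - (2 - 4 / d * dist q') = 4 / d * (dist q' -
    dist q) by ring.
  rewrite normrM (@ger0_norm _ (4 / d)) ?divr_ge0// ?(ltW d0)//.
  rewrite -ler_pdivlMl ?divr_gt0//.
  apply: (@le_trans _ _ `|q - q'|).
    rewrite ler_norml; have := dist_lipschitz q q' A0.
    by have := dist_lipschitz q' q A0; rewrite (distrC q' q); lra.
  near: q'; have /cvgrPdist_le := @cvg_id _ (nbhs q); apply.
  by rewrite mulr_gt0// invr_gt0 divr_gt0.
exists (fun q => chi q *: w q), d^-1; split.
- move=> q; have [qd|dq] := ltP (dist q) d.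
    have [p Ap qp] := dist_lt A0 qd; have [wq _] := dE p Ap q qp.
    by apply: cvgZ; [exact: chic | exact: wq].
  have d2q : d / 2 < dist q by lra.
  have vq0 : chi q *: w q = 0 by rewrite chi0 ?scale0r// ltW.
  rewrite /continuous_at vq0.
  apply: (@cvg_trans _ (cst (0 : E) @ q)); last exact: cvg_cst.
  apply: near_eq_cvg; near=> q'.
  rewrite /= chi0 ?scale0r//.
  have : `|q - q'| <= dist q - d / 2.
    by near: q'; have /cvgrPdist_le := @cvg_id _ (nbhs q); apply;
      rewrite subr_gt0.
  by have := dist_lipschitz q q' A0; lra.
- move=> q; have [qd|dq] := ltP (dist q) d.
    have [p Ap qp] := dist_lt A0 qd; have [_ wq] := dE p Ap q qp.
    rewrite normrZ ger0_norm// -div1r ler_pdivlMr// mulrC.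
    rewrite mulrCA; apply: le_trans wq; rewrite ler_piMl// mulr_ge0// ltW//.
  by rewrite chi0 ?scale0r ?normr0 ?invr_ge0 ?(ltW d0)//; lra.
- move=> p Ap; near=> q; rewrite chi1 ?scale1r//.
  apply: le_trans (dist_le q Ap) _; rewrite distrC.
  by near: q; have /cvgrPdist_le := @cvg_id _ (nbhs p); apply; rewrite divr_gt0.
Unshelve. all: by end_near. Qed.

End Cutoff.

(** * The graph of the feasible part of the basin *)

Section Basin.
Context {R : realType} {n m : nat}.
Variables (f : 'rV[R]_n -> R -> R) (h : 'rV[R]_n -> R -> 'rV[R]_m).
Hypotheses (fh_smooth : smoothness f h) (h_LICQ : LICQ h).
Variables (a b : R) (V : set (R * 'rV[R]_n)).
Hypotheses (a_ge0 : 0 <= a) (V_basin : contracting_basin f h V a b).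

Lemma basin_openV : open V.
Proof. by case: V_basin => -[]. Qed.

Lemma KsetE (t : R) x : a < t < b ->
  Kset h V t x <-> closure (xsection V t) x /\ h x t = 0.
Proof. by case: V_basin => -[_ _ _ _ /(_ t) VK] _ /VK[-> _]. Qed.

(** Upper hemicontinuity, applied to the complement of a small closed ball around [x], keeps the
    slices at nearby times off that ball: the correspondence has a closed graph. *)
Lemma not_closure_slice_near (x : 'rV[R]_n) (t : R) : a < t < b ->
  ~ closure (xsection V t) x ->
  \forall q \near (x, t), ~ closure (xsection V q.2) q.1.
Proof.
move=> tab /asboolPn/existsp_asboolPn[N].
move=> /asboolPn/imply_asboolPn[/nbhs_ballP[r /= r0 rN] NV].
pose O := ~` closure (ball x (r / 2)).
have Oopen : open O by apply: closed_openC; exact: closed_closure.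
have r4 : 0 < r / 4 by rewrite divr_gt0.
have VO : closure (xsection V t) `<=` O.
  move=> y yV yU; apply: NV.
  have [z [Vz yz]] := yV _ (nbhsx_ballx y (r / 4) r4).
  have [u [xu yu]] := yU _ (nbhsx_ballx y (r / 4) r4).
  exists z; split=> //; apply: rN; move: xu yu yz; rewrite -!ball_normE/=.
  have := ler_distD u x z; have := ler_distD y u z; rewrite (distrC u y); lra.
have [_ _ _ /(_ t) uhc _] := V_basin.1.
have {uhc} := uhc ltac:(by rewrite /= in_itv) _ Oopen VO.
rewrite near_withinE => Vnear.
have tabnear : \forall s \near t, s \in `]a, b[.
  case/andP: tab => at_ tb; near=> s; rewrite in_itv/=.
  by apply/andP; split; near: s; [exact: lt_nbhsr | exact: lt_nbhsl].
have Vnear2 : \forall q \near (x, t), closure (xsection V q.2) `<=` O.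
  have : \forall s \near t, closure (xsection V s) `<=` O.
    by apply: filterS2 Vnear tabnear => s sV sI; exact: sV.
  exact: (@cvg_snd _ _ (nbhs x) (nbhs t)).
have xnear : \forall q \near (x, t), ball x (r / 2) q.1.
  have : \forall y \near x, ball x (r / 2) y by apply: nbhsx_ballx;
    rewrite divr_gt0.
  exact: (@cvg_fst _ _ (nbhs x) (nbhs t)).
apply: filterS2 Vnear2 xnear => q qV xq qcl.
by apply: (qV _ qcl); exact: subset_closure.
Unshelve. all: by end_near. Qed.

Variables (t0 t1 : R).
Hypotheses (a_lt_t0 : a < t0) (t0_le_t1 : t0 <= t1) (t1_lt_b : t1 < b).

Lemma time_itv (t : R) : t0 <= t <= t1 -> a < t < b.
Proof. by move=> /andP[/(lt_le_trans a_lt_t0)-> /le_lt_trans->]. Qed.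

Lemma time_gt0 (t : R) : t0 <= t <= t1 -> 0 < t.
Proof. by move=> /time_itv/andP[/(le_lt_trans a_ge0)]. Qed.

(* In contrast to [V], the time is the second component. *)
Definition Kgraph : set ('rV[R]_n * R) :=
  [set p | t0 <= p.2 <= t1 /\ Kset h V p.2 p.1].

Lemma Kgraph_bounded : exists2 B, 0 < B & forall p, Kgraph p -> `|p.1| <= B.
Proof.
have dB : \forall d \near 0^'+, forall t, `[t0, t1]%classic t ->
    forall x, xsection V t x -> d * `|x| <= 1.
  apply: compact_near_within; first exact: segment_compact.
  move=> t; rewrite /= in_itv => /time_itv tab.
  have [_ _ /(_ t) Vlb _ _] := V_basin.1.
  have [D /compact_bounded[M [_ DM]]] := Vlb ltac:(by rewrite /= in_itv).
  rewrite near_withinE => VD.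
  near=> s d => sI x Vx.
  have d0 : 0 <= d by near: d; exact: nbhs_right_ge.
  have sab : `]a, b[%classic s by move: sI; rewrite /= !in_itv; exact: time_itv.
  have xM : `|x| <= `|M| + 1.
    apply: (DM (`|M| + 1)); first by rewrite ltr_pwDr// ler_norm.
    by have VDs := near VD s; exact: (VDs _ sab x Vx).
  have dM : d <= (`|M| + 1)^-1.
    by near: d; apply: nbhs_right_le; rewrite invr_gt0 ltr_wpDl.
  apply: le_trans (ler_pM d0 (normr_ge0 _) dM xM) _.
  by rewrite mulVf// lt0r_neq0// ltr_wpDl.
near (0 : R)^'+ => d; have d0 : 0 < d by near: d; exact: nbhs_right_gt.
(* The slices lie within [d^-1] of the origin; the 1 pays for passing to their closures. *)
exists (d^-1 + 1) => [|[x t] [/= tI /closureI[+ _]]].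
  by rewrite ltr_wpDl// invr_ge0 ltW.
move=> /(_ _ (nbhsx_ballx x 1 ltr01))[z [Vz]]; rewrite -ball_normE/= => xz.
have zd : `|z| <= d^-1.
  rewrite -div1r ler_pdivlMr// mulrC.
  have dBd : forall t, `[t0, t1]%classic t ->
    forall x, xsection V t x -> d * `|x| <= 1 by near: d.
  by apply: (dBd t) Vz; rewrite /= in_itv.
have := ler_distD z x 0; rewrite !subr0; lra.
Unshelve. all: by end_near. Qed.

(** By the basin identity, a point off the graph violates the time range, the closure of the slice
    or the equation [h = 0], and each violation persists on a neighbourhood. So the graph is closed
    in a compact cylinder. *)
Lemma Kgraph_compact : compact Kgraph.
Proof.
have [B _ BE] := Kgraph_bounded.
apply: subclosed_compact (@compact_cylinder _ _ B t0 t1) _; last first.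
  by move=> p pK; split; [exact: BE | case: pK].
rewrite closedE => -[x t] nK; apply: contrapT => nKp; apply: nK.
have [tI|tnI] := boolP (t0 <= t <= t1); last first.
  suff tn : \forall s \near t, ~~ (t0 <= s <= t1).
    have : \forall q \near (x, t), ~~ (t0 <= q.2 <= t1).
      exact: (@cvg_snd _ _ (nbhs x) (nbhs t) _ [set s | ~~ (t0 <= s <= t1)] tn).
    by apply: filterS => q /negP qI [].
  move: tnI; rewrite negb_and -!ltNge => /orP[tt0|t1t].
    have := lt_nbhsl tt0; apply: filterS => s st0.
    by rewrite negb_and -ltNge st0.
  have := lt_nbhsr t1t; apply: filterS => s t1s.
  by rewrite negb_and -!ltNge t1s orbT.
have tab := time_itv tI; have tpos := time_gt0 tI.
have [xV|nxV] := pselect (closure (xsection V t) x).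
  have hx : h x t != 0 by apply/eqP => hx; apply: nKp; split=> //; exact/KsetE.
  have hp := cvgr_neq0 _ (continuous_h fh_smooth tpos) hx.
  near=> q => -[/= sI /KsetE[|_]]; first exact: time_itv.
  by apply/eqP; near: q; exact: hp.
have nV := not_closure_slice_near tab nxV.
near=> q => -[/= sI /KsetE[|+ _]]; first exact: time_itv.
by near: q; exact: nV.
Unshelve. all: by end_near. Qed.

Lemma Kgraph_row_free p : Kgraph p -> row_free (Jac h p.1 p.2).
Proof.
case: p => x t [/= tI /KsetE[|_ hx]]; first exact: time_itv.
by apply: h_LICQ => //; exact/ltW/time_gt0.
Qed.

End Basin.

(** * Feasibility along trajectories and the cut-off flow *)

Section Flow.
Context {R : realType} {n m : nat}.
Variables (f : 'rV[R]_n -> R -> R) (h : 'rV[R]_n -> R -> 'rV[R]_m).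
Hypotheses (fh_smooth : smoothness f h) (h_LICQ : LICQ h).
Variables (a b : R) (V : set (R * 'rV[R]_n)).
Hypotheses (a_ge0 : 0 <= a) (V_basin : contracting_basin f h V a b).
Variables (t0 t1 : R).
Hypotheses (a_lt_t0 : a < t0) (t0_le_t1 : t0 <= t1) (t1_lt_b : t1 < b).

Local Notation K := (Kgraph h V t0 t1).

(** The projected gradient is tangent and the drift cancels the time derivative of [h]. This holds
    at any regular point, feasible or not, which is what lets feasibility propagate. *)
Lemma constraint_derive alpha (x : R -> 'rV[R]_n) (t : R) (j : 'I_m) :
  0 < t -> row_free (Jac h (x t) t) ->
  is_derive t 1 x (velocity f h alpha (x t) t) ->
  is_derive t 1 (fun s => h (x s) s 0 j) 0.
Proof.
move=> tpos Jx xv.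
have [_ _ _ [dh _ _] _] := fh_smooth.
have hx := differentiable_h fh_smooth (x t) (ltW tpos).
have near_dh : \forall q \near (x t, t), derivable (h q.1) q.2 1.
  near=> q; apply: dh; near: q.
  exact: (near_snd (P := [set s | 0 <= s]) _ (lt_le_nbhsr tpos)).
have := is_derive1_comp2_linear (@continuous_row_coord _ _ j) near_dh
  (continuous_dth fh_smooth tpos) hx xv.
suff -> : 'D_(velocity f h alpha (x t) t) (h^~ t) (x t) + 'D_1 (h (x t)) t = 0.
  by rewrite linear0.
rewrite (derive_Jac _ hx) velocityE trmxK mulmxDr mulmxN -scalemxAr.
rewrite (Jac_pgrad _ Jx) (Jac_drift Jx) scaler0 oppr0 add0r linearN/= trmxK.
by rewrite addNr.
Unshelve. all: by end_near. Qed.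

Lemma constraint_conserved alpha (x : R -> 'rV[R]_n) (s1 s2 : R) : s1 <= s2 ->
  (forall t, s1 <= t <= s2 -> [/\ 0 < t, row_free (Jac h (x t) t) &
    is_derive t 1 x (velocity f h alpha (x t) t)]) ->
  h (x s1) s1 = h (x s2) s2.
Proof.
move=> s12 xE; apply/rowP => j.
have dh t : t \in `[s1, s2] -> is_derive t 1 (fun s => h (x s) s 0 j) 0.
  by rewrite in_itv => /xE[tpos Jx xv]; exact: constraint_derive tpos Jx xv.
have hc : {within `[s1, s2], continuous (fun s => h (x s) s 0 j)}.
  by apply: derivable_within_continuous => t /dh[].
have [t _] := MVT_segment s12 (fun t tI => dh t (subset_itv_oo_cc tI)) hc.
by rewrite mul0r => /eqP; rewrite subr_eq0 => /eqP.
Qed.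

(* Satisfied both by the solutions and by the flow of the cut-off field. *)
Definition velocity_near_K alpha (x : R -> 'rV[R]_n) := forall t, K (x t, t) ->
  {for t, continuous x} /\ \forall s \near t, t0 <= s <= t1 ->
    is_derive s 1 x (velocity f h alpha (x s) s).

(** Full rank and membership in the open [V] survive at nearby times, where [h] is then constant
    along the curve. There is no circularity: [velocity_near_K] gives the velocity on a
    neighbourhood of [t] before feasibility there is known. *)
Lemma Kgraph_persist alpha (x : R -> 'rV[R]_n) (t : R) :
  velocity_near_K alpha x -> K (x t, t) -> V (t, x t) ->
  \forall s \near t, t0 <= s <= t1 -> K (x s, s).
Proof.
move=> xE Kt Vt; have [xc xv] := xE t Kt.
have tI : t0 <= t <= t1 by case: Kt.
have tpos := time_gt0 a_ge0 a_lt_t0 t1_lt_b tI.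
have Jx := Kgraph_row_free h_LICQ a_ge0 V_basin a_lt_t0 t1_lt_b Kt.
have [xct sct] := cvg_graph xc.
have Jnear : \forall s \near t, row_free (Jac h (x s) s).
  exact: (xct _ (near_row_free fh_smooth tpos Jx)).
have Vnear : \forall s \near t, V (s, x s).
  apply: sct; apply: open_nbhs_nbhs; split=> //; exact: basin_openV V_basin.
have tnear : \forall s \near t, 0 < s by exact: lt_nbhsr.
have /nbhs_ballP[r /= r0 rE] : nbhs t [set s | [/\ 0 < s, row_free (Jac h (x s)
  s),
    V (s, x s) & t0 <= s <= t1 -> is_derive s 1 x (velocity f h alpha (x s)
      s)]].
  by near=> s; split; near: s;
    [exact: tnear|exact: Jnear|exact: Vnear|exact: xv].
have hxt : h (x t) t = 0.
  have [_ /(KsetE V_basin)[]//] := Kt; exact: (time_itv a_lt_t0 t1_lt_b).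
apply/nbhs_ballP; exists r; first exact: r0.
move=> s rs sI; have [_ _ Vs _] := rE _ rs; split; first exact: sI.
apply/(KsetE V_basin); first exact: (time_itv a_lt_t0 t1_lt_b).
split; first by apply: subset_closure; rewrite /xsection/= inE.
move: rs; rewrite -ball_normE/= => rs.
have seg u : Num.min t s <= u <= Num.max t s -> [/\ 0 < u, row_free (Jac h (x
  u) u) &
    is_derive u 1 x (velocity f h alpha (x u) u)].
  move=> uts; have ur : ball t r u.
    move: uts rs; rewrite -ball_normE/= !ltr_norml.
    by case: (leP t s) => ts /andP[]; lra.
  have uI : t0 <= u <= t1.
    by move: uts tI sI; case: (leP t s) => ts /andP[]; lra.
  by have [upos Ju _ /(_ uI)] := rE _ ur.
have [ts|/ltW st] := leP t s.
  apply: etrans (esym (constraint_conserved ts _)) hxt.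
  by move=> u uts; apply: seg; rewrite min_l// max_r.
apply: etrans (constraint_conserved st _) hxt.
by move=> u uts; apply: seg; rewrite min_r// max_l.
Unshelve. all: by end_near. Qed.

(** [J] keeps full rank near the compact graph, so the velocity is continuous there and can be cut
    off to a bounded continuous field on the whole space, to which Peano's theorem applies. *)
Lemma cutoff_flow alpha p : K p -> exists2 x : R -> 'rV[R]_n, x p.2 = p.1 &
  (forall t : R, derivable x t 1) /\ velocity_near_K alpha x.
Proof.
move=> Kp.
have [q Kq|v [M [vc vM vE]]] := cutoff (A := K)
  (w := fun q => velocity f h alpha q.1 q.2)
  (Kgraph_compact fh_smooth a_ge0 V_basin a_lt_t0 t1_lt_b).
  have q2 : 0 < q.2 by case: Kq => /(time_gt0 a_ge0 a_lt_t0 t1_lt_b).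
  have Jq := Kgraph_row_free h_LICQ a_ge0 V_basin a_lt_t0 t1_lt_b Kq.
  have Jnear : \forall q' \near q, row_free (Jac h q'.1 q'.2).
    case: q q2 Jq {Kq} => y s /= s0 Js; exact: (near_row_free fh_smooth s0 Js).
  have pos_near : \forall q' \near q, 0 < q'.2.
    case: q q2 {Kq Jq Jnear} => y s /= s0.
    exact: (near_snd (P := [set s | 0 < s]) _ (lt_nbhsr s0)).
  near=> q'.
  have Jq' : row_free (Jac h q'.1 q'.2) by near: q'.
  have q'2 : 0 < q'.2 by near: q'.
  have := cvg_velocity fh_smooth q'2 Jq' (alpha := alpha).
  by case: (q').
have vc' : continuous (fun q : 'rV[R]_n * R => v (q.1, q.2)).
  by have -> : (fun q => v (q.1, q.2)) = v by apply/funext => -[].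
have [x xp xE] := @peano _ _ (fun y s => v (y, s)) M p.2 p.1 vc'
  (fun y s => vM (y, s)).
exists x => //; split=> [t|t Kt]; first by case: (xE t).
have xc := is_derive1_continuous (xE t); split=> //.
have [xct _] := cvg_graph xc.
have vnear := xct _ (vE _ Kt); near=> s => _.
have vs : v (x s, s) = velocity f h alpha (x s) s by near: s; exact: vnear.
by rewrite -vs; exact: xE.
Unshelve. all: by end_near. Qed.

End Flow.

(** * The optimal value *)

Section OptimalValue.
Context {R : realType} {n m : nat}.
Variables (f : 'rV[R]_n -> R -> R) (h : 'rV[R]_n -> R -> 'rV[R]_m).
Hypotheses (fh_smooth : smoothness f h) (h_LICQ : LICQ h).
Variables (a b : R) (V : set (R * 'rV[R]_n)).
Hypotheses (a_ge0 : 0 <= a) (V_basin : contracting_basin f h V a b).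
Variables (t0 t1 : R).
Hypotheses (a_lt_t0 : a < t0) (t1_lt_b : t1 < b).

Local Notation K := (Kgraph h V t0 t1).
Local Notation fs := (fstar f h V).

Lemma fstar_min (t : R) : t0 <= t <= t1 ->
  exists2 x, Kstar f h V t x & fs t = f x t.
Proof.
move=> tI; have tab := time_itv a_lt_t0 t1_lt_b tI.
have [B B0 BE] := Kgraph_bounded V_basin a_lt_t0 t1_lt_b.
have Kco : compact (Kset h V t).
  apply: bounded_closed_compact; last exact: closed_closure.
  exists B; split=> [|C BC x Kx]; first exact: num_real.
  by apply: le_trans (ltW BC); apply: (BE (x, t)).
have K0 : Kset h V t !=set0.
  have [_ _ _ _ /(_ _ tab)[_ [x Vx]]] := V_basin.1.
  by exists x; exact: subset_closure.
have [x /set_mem Kx xmin] := EVT_min_rV K0 Kco (f := f^~ t)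
  (continuous_subspaceT (fun y => differentiable_continuous
     (differentiable_f fh_smooth y (ltW (time_gt0 a_ge0 a_lt_t0 t1_lt_b tI))))).
have xle y : Kset h V t y -> f x t <= f y t by move=> Ky; apply: xmin;
  rewrite inE.
exists x => //; apply/eqP; rewrite eq_le; apply/andP; split.
  by apply: ge_inf; [exists (f x t) => _ [y Ky <-]; exact: xle | exists x].
by apply: lb_le_inf => [|_ [y Ky <-]]; [exists (f x t), x | exact: xle].
Qed.

Lemma fstar_le (t : R) x : t0 <= t <= t1 -> Kset h V t x -> fs t <= f x t.
Proof. by move=> /fstar_min[y [_ ymin] ->]; exact: ymin. Qed.

Lemma fstar_ge_Kstar (t : R) x : t0 <= t <= t1 -> Kset h V t x ->
  f x t <= fs t -> Kstar f h V t x.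
Proof.
move=> tI Kx xfs; split=> // y Ky; exact: le_trans xfs (fstar_le tI Ky).
Qed.

Lemma Kstar_critical (t : R) x : t0 <= t <= t1 ->
  Kstar f h V t x <-> V (t, x) /\ critical_points f h t x.
Proof.
move=> tI; rewrite -(V_basin.2 t (time_itv a_lt_t0 t1_lt_b tI)).
by rewrite /setI/= /xsection/= inE.
Qed.

(* Upper semicontinuity: a minimizer at time [t] is carried to feasible points at
   the nearby times by the flow of [velocity 0], which is the drift alone
   because [0^-1 = 0]. *)
Lemma fstar_continuous (t : R) (e : R) : t0 <= t <= t1 -> 0 < e ->
  \forall s \near t, t0 <= s <= t1 -> `|fs s - fs t| < e.
Proof.
move=> tI e0; have tpos := time_gt0 a_ge0 a_lt_t0 t1_lt_b tI.
have [x0 x0K fsE] := fstar_min tI.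
have upper : \forall s \near t, t0 <= s <= t1 -> fs s < fs t + e.
  have Kx0 : K (x0, t) by split=> //; case: x0K.
  have [x /= xt [_ xK]] := cutoff_flow fh_smooth h_LICQ a_ge0 V_basin a_lt_t0
    t1_lt_b 0 Kx0.
  rewrite -xt in Kx0; have [xc _] := xK t Kx0.
  have Vx : V (t, x t) by rewrite xt; have [] := (Kstar_critical x0 tI).1 x0K.
  have Kper := Kgraph_persist fh_smooth h_LICQ a_ge0 V_basin a_lt_t0 t1_lt_b xK
    Kx0 Vx.
  have [xct _] := cvg_graph xc.
  have fxc := cvg_comp _ _ xct (continuous_f fh_smooth tpos).
  have fnear : \forall s \near t, f (x s) s < fs t + e.
    by apply: (cvgr_lt _ fxc); rewrite /= xt -fsE ltrDl.
  near=> s => sI; apply: (@le_lt_trans _ _ (f (x s) s)); last by near: s;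
    exact: fnear.
  have [] : K (x s, s) by move: sI; near: s; exact: Kper.
  by move=> _ /(fstar_le sI).
(* Lower semicontinuity by a covering in [x]: a point of a ball containing all the sets [K(s)]
   either lies off the closed graph at time [t], together with its neighbours, or satisfies
   [f x t >= fs t], which nearly persists. *)
have lower : \forall s \near t, t0 <= s <= t1 -> fs t - e < fs s.
  have [B _ BE] := Kgraph_bounded V_basin a_lt_t0 t1_lt_b.
  have /compact_near_coveringP Bcov := @compact_norm_le R n B.
  have := Bcov _ (nbhs t) (fun s x => K (x, s) -> fs t - e < f x s) _.
  suff H : forall x : 'rV[R]_n, `|x| <= B ->
      \forall x' \near x & s \near t, K (x', s) -> fs t - e < f x' s.
    move=> /(_ _ H) cov; near=> s => sI.
    have [y [Ky _] ->] := fstar_min sI.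
    have covs : [set x : 'rV[R]_n | `|x| <= B] `<=`
      (fun x => K (x, s) -> fs t - e < f x s) by near: s; exact: cov.
    have Kys : K (y, s) by [].
    by apply: covs => //; exact: (BE _ Kys).
  move=> x _; have [Kx|nKx] := pselect (K (x, t)).
    have fx : fs t - e < f x t.
      by apply: lt_le_trans (fstar_le tI Kx.2); rewrite ltrBlDr ltrDl.
    have fnear := cvgr_gt _ (continuous_f fh_smooth tpos) _ fx.
    have : \forall q \near (x, t), K q -> fs t - e < f q.1 q.2.
      by near=> q => _; near: q; exact: fnear.
    apply: filterS => -[y s]; exact.
  have Kcl : closed K.
    apply: compact_closed; first exact: norm_hausdorff.
    exact: (Kgraph_compact fh_smooth a_ge0 V_basin a_lt_t0 t1_lt_b).
  have nK : nbhs (x, t) (~` K).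
    by apply: open_nbhs_nbhs; split=> //; exact: closed_openC.
  by apply: filterS nK => -[y s] /= nKys.
near=> s => sI; rewrite ltr_distl.
apply/andP; split; first by move: sI; near: s; exact: lower.
by move: sI; near: s; exact: upper.
Unshelve. all: by end_near. Qed.

End OptimalValue.

(** * Descent *)

Lemma mulmx_velocity (R : realType) (n m : nat) (f : 'rV[R]_n -> R -> R)
    (h : 'rV[R]_n -> R -> 'rV[R]_m) alpha x t (g : 'cV[R]_n) :
  (g^T *m (velocity f h alpha x t)^T) 0 0 =
  - (alpha^-1 * (g^T *m pgrad f h x t) 0 0) + (g^T *m drift h x t) 0 0.
Proof.
rewrite velocityE trmxK; move: (pgrad f h x t) (drift h x t) => p q.
by rewrite mulmxDr mulmxN -scalemxAr; move: (_ *m p) (_ *m q) => u v;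
  rewrite !mxE.
Qed.

Section Energy.
Context {R : realType} {n m : nat}.
Variables (f : 'rV[R]_n -> R -> R) (h : 'rV[R]_n -> R -> 'rV[R]_m).
Hypotheses (fh_smooth : smoothness f h) (h_LICQ : LICQ h).
Variables (a b : R) (V : set (R * 'rV[R]_n)).
Hypotheses (a_ge0 : 0 <= a) (V_basin : contracting_basin f h V a b).
Variables (t0 t1 : R).
Hypotheses (a_lt_t0 : a < t0) (t1_lt_b : t1 < b).

Local Notation K := (Kgraph h V t0 t1).
Local Notation fs := (fstar f h V).

Variables (l : R -> R) (N eta : R).
Hypotheses (N_ge0 : 0 <= N) (l_lipschitz : forall s t, `|l s - l t| <= N * `|s
  - t|).
Hypotheses (eta_gt0 : 0 < eta) (eta_lt_l : forall t, eta < l t).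
Hypothesis l_boundary : forall p, K p -> ~ V (p.2, p.1) ->
  l p.2 < f p.1 p.2 - fs p.2.

Local Ltac lra_core := clear - fh_smooth h_LICQ a_ge0 V_basin a_lt_t0 t1_lt_b
  N_ge0 l_lipschitz eta_gt0 eta_lt_l l_boundary; lra.

Definition excess (p : 'rV[R]_n * R) : R := f p.1 p.2 - fs p.2 - l p.2.

Lemma l_near (t e : R) : 0 < e -> \forall s \near t, `|l s - l t| < e.
Proof.
move=> e0; near=> s; apply: le_lt_trans (l_lipschitz _ _) _.
apply: (@le_lt_trans _ _ ((N + 1) * `|s - t|));
  first by rewrite ler_wpM2r// lerDl.
rewrite -ltr_pdivlMl ?ltr_wpDl// distrC.
near: s; have /cvgrPdist_lt := @cvg_id _ (nbhs t); apply.
by rewrite mulr_gt0// invr_gt0 ltr_wpDl.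
Unshelve. all: by end_near. Qed.

Lemma excess_continuous p e : K p -> 0 < e ->
  \forall q \near p, K q -> `|excess q - excess p| < e.
Proof.
case: p => x t Kp e0; have e3 : 0 < e / 3 by rewrite divr_gt0.
have tI : t0 <= t <= t1 := Kp.1.
have tpos := time_gt0 a_ge0 a_lt_t0 t1_lt_b tI.
have fnear : \forall q \near (x, t), `|f x t - f q.1 q.2| < e / 3.
  have fc : f q.1 q.2 @[q --> (x, t)] --> f x t := continuous_f fh_smooth tpos.
  by move/cvgrPdist_lt : fc; apply.
have fsnear := fstar_continuous fh_smooth h_LICQ a_ge0 V_basin a_lt_t0 t1_lt_b
  tI e3.
have fsq := near_snd (P := [set s | t0 <= s <= t1 -> `|fs s - fs t| < e / 3]) x
  fsnear.
have lq := near_snd (P := [set s | `|l s - l t| < e / 3]) x (l_near t e3).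
near=> q => Kq; rewrite /excess/=.
have h1 : `|f x t - f q.1 q.2| < e / 3 by near: q; exact: fnear.
have h2 : `|fs q.2 - fs t| < e / 3 by move: Kq.1; near: q; exact: fsq.
have h3 : `|l q.2 - l t| < e / 3 by near: q; exact: lq.
by move: h1 h2 h3; rewrite !ltr_norml; lra.
Unshelve. all: by end_near. Qed.

(** The gradient carries its own time [z.2]: descent is measured for [f] at the entry time, while
    the velocity is that of the current time. *)
Lemma cvg_rate (u : 'rV[R]_n -> R -> 'cV[R]_n) (p : 'rV[R]_n * R) : 0 < p.2 ->
  u q.1 q.2 @[q --> p] --> u p.1 p.2 ->
  ((grad f z.1.1 z.2)^T *m u z.1.1 z.1.2) 0 0 @[z --> (p, p.2)] -->
  ((grad f p.1 p.2)^T *m u p.1 p.2) 0 0.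
Proof.
case: p => x t /= tpos ux.
have fstz : z.1 @[z --> ((x, t), t)] --> (x, t) by exact: cvg_fst.
have uz : u z.1.1 z.1.2 @[z --> ((x, t), t)] --> u x t := cvg_comp _ _ fstz ux.
have xz : (z.1.1, z.2) @[z --> ((x, t), t)] --> (x, t).
  apply: (cvg_pair (G := nbhs x) (H := nbhs t)); last exact: cvg_snd.
  exact: (cvg_comp _ _ fstz (@cvg_fst _ _ (nbhs x) (nbhs t) _)).
have gz : grad f z.1.1 z.2 @[z --> ((x, t), t)] --> grad f x t.
  exact: (cvg_comp _ _ xz (cvg_grad fh_smooth tpos)).
exact: ((cvg_mxP _ _).1 (cvg_mulmx (cvg_trmx gz) uz) 0 0).
Qed.

(** A point of the closed band is in [V], since boundary points lie above the level, and is no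
    minimizer, since [f - f* >= l - eta > 0] there. The contracting property then excludes critical
    points, so the rate is positive. *)
Lemma descent_rate : \forall d \near 0^'+, forall p, K p ->
  - eta < excess p < 0 -> forall s, `|s - p.2| <= d ->
  d <= ((grad f p.1 s)^T *m pgrad f h p.1 p.2) 0 0.
Proof.
apply: compact_near_within.
  exact: (Kgraph_compact fh_smooth a_ge0 V_basin a_lt_t0 t1_lt_b).
move=> p Kp; have tI := Kp.1; have tpos := time_gt0 a_ge0 a_lt_t0 t1_lt_b tI.
(* Points off the closed band have neighbours off the open one, where the claim is vacuous. *)
have [/andP[ep1 ep2]|] := boolP (- eta <= excess p <= 0); last first.
  rewrite negb_and -!ltNge => ep.
  have [e e0 eE] : exists2 e, 0 < e & forall r, `|r - excess p| < e -> ~ (- eta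
    < r < 0).
    case/orP: ep => ep.
      exists (- eta - excess p) => [|r]; first by rewrite subr_gt0.
      by rewrite ltr_norml; lra.
    by exists (excess p) => // r; rewrite ltr_norml; lra.
  have enear := excess_continuous Kp e0.
  near=> q d.
  have eq : K q -> `|excess q - excess p| < e by near: q; exact: enear.
  by move=> /eq/eE qe /qe.
have Vp : V (p.2, p.1).
  apply: contrapT => nV; have := l_boundary Kp nV.
  by move: ep2; rewrite /excess; lra.
have Jp := Kgraph_row_free h_LICQ a_ge0 V_basin a_lt_t0 t1_lt_b Kp.
have hp : feasible_set h p.2 p.1.
  by have [_ /(KsetE V_basin p.1 (time_itv a_lt_t0 t1_lt_b tI))[]] := Kp.
set r0 := ((grad f p.1 p.2)^T *m pgrad f h p.1 p.2) 0 0.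
have r0pos : 0 < r0.
  have r0E : r0 = \sum_i pgrad f h p.1 p.2 i 0 ^+ 2.
    rewrite /r0 (grad_pgrad _ Jp) mxE; apply: eq_bigr => i _.
    by rewrite [(_^T) _ _]mxE expr2.
  rewrite lt_neqAle r0E sumr_ge0 ?andbT => [|i _]; last exact: sqr_ge0.
  apply/negP => /eqP /esym r00.
  have pg0 : pgrad f h p.1 p.2 = 0.
    apply/colP => i; rewrite [RHS]mxE; apply/eqP; rewrite -sqrf_eq0.
    by move: r00 => /eqP; rewrite psumr_eq0 => [/allP/(_ i)|j _];
      [rewrite mem_index_enum; apply | exact: sqr_ge0].
  have [_ Kmin] := (Kstar_critical V_basin a_lt_t0 t1_lt_b p.1 tI).2
    (conj Vp (pgrad_eq0_critical hp pg0)).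
  have [y [Ky _] fsE] := fstar_min fh_smooth a_ge0 V_basin a_lt_t0 t1_lt_b tI.
  have := Kmin y Ky; have := eta_lt_l p.2; move: ep1; rewrite /excess fsE; lra.
have pgc : pgrad f h q.1 q.2 @[q --> p] --> pgrad f h p.1 p.2.
  by case: (p) tpos Jp => x t tpos Jp; exact: (cvg_pgrad fh_smooth tpos Jp).
have r2 : r0 / 2 < r0 by rewrite ltr_pdivrMr// mulr_natr mulr2n ltrDl.
have [[A B] [/= pA B0] AB] := near_time (Q := fun q s =>
  r0 / 2 < ((grad f q.1 s)^T *m pgrad f h q.1 q.2) 0 0)
  (cvgr_gt _ (cvg_rate tpos pgc) _ r2).
near=> q d => _ _ s sd.
have Aq : A q by near: q.
have Bd : B d by near: d.
have dr : d <= r0 / 2 by near: d; apply: nbhs_right_le; rewrite divr_gt0.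
by apply: (le_trans dr); apply/ltW; apply: (AB (q, d)).
Unshelve. all: by end_near. Qed.

Lemma drift_rate : \forall d \near 0^'+, forall p, K p ->
  forall s, `|s - p.2| <= d ->
  d * ((grad f p.1 s)^T *m drift h p.1 p.2) 0 0 <= 1.
Proof.
apply: compact_near_within.
  exact: (Kgraph_compact fh_smooth a_ge0 V_basin a_lt_t0 t1_lt_b).
move=> p Kp; have tpos := time_gt0 a_ge0 a_lt_t0 t1_lt_b Kp.1.
have Jp := Kgraph_row_free h_LICQ a_ge0 V_basin a_lt_t0 t1_lt_b Kp.
have dc : drift h q.1 q.2 @[q --> p] --> drift h p.1 p.2.
  by case: p tpos Jp {Kp} => x t tpos Jp; exact: (cvg_drift fh_smooth tpos Jp).
pose r0 := ((grad f p.1 p.2)^T *m drift h p.1 p.2) 0 0.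
have rlt : r0 < `|r0| + 1 by rewrite ltr_pwDr// ler_norm.
have [[A B] [/= pA B0] AB] := near_time (Q := fun q s =>
  ((grad f q.1 s)^T *m drift h q.1 q.2) 0 0 < `|r0| + 1)
  (cvgr_lt _ (cvg_rate tpos dc) _ rlt).
near=> q d => _ s sd.
have Aq : A q by near: q.
have Bd : B d by near: d.
have d_ge0 : 0 <= d by near: d; exact: nbhs_right_ge.
have dr : d <= (`|r0| + 1)^-1.
  by near: d; apply: nbhs_right_le; rewrite invr_gt0 ltr_wpDl.
apply: (@le_trans _ _ (d * (`|r0| + 1))).
  by apply: ler_wpM2l d_ge0 _ _ _; apply/ltW; apply: (AB (q, d)).
apply: (@le_trans _ _ ((`|r0| + 1)^-1 * (`|r0| + 1))).
  by rewrite ler_wpM2r// addr_ge0.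
by rewrite mulVf// lt0r_neq0// ltr_wpDl.
Unshelve. all: by end_near. Qed.

Lemma f_time_modulus : \forall d \near 0^'+, forall p, K p ->
  forall s, `|s - p.2| <= d -> `|f p.1 s - f p.1 p.2| <= eta / 4.
Proof.
apply: compact_near_within.
  exact: (Kgraph_compact fh_smooth a_ge0 V_basin a_lt_t0 t1_lt_b).
move=> [x t] Kp; have tpos := time_gt0 a_ge0 a_lt_t0 t1_lt_b Kp.1.
have e8 : 0 < eta / 8 by rewrite divr_gt0.
have fc : f q.1 q.2 @[q --> (x, t)] --> f x t := continuous_f fh_smooth tpos.
have fnear : \forall q \near (x, t), `|f x t - f q.1 q.2| < eta / 8.
  by move/cvgrPdist_lt : fc; apply.
have xz : (z.1.1, z.2) @[z --> ((x, t), t)] --> (x, t).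
  apply: (cvg_pair (G := nbhs x) (H := nbhs t)); last exact: cvg_snd.
  exact: (cvg_comp _ _ (@cvg_fst _ _ (nbhs (x, t)) (nbhs t) _)
    (@cvg_fst _ _ (nbhs x) (nbhs t) _)).
have [[A B] [/= pA B0] AB] := near_time (Q := fun q s => `|f x t - f q.1 s| <
  eta / 8)
  (xz _ fnear).
near=> q d => _ s sd.
have Aq : A q by near: q.
have Bd : B d by near: d.
have h1 : `|f x t - f q.1 q.2| < eta / 8 by near: q; exact: fnear.
have h2 : `|f x t - f q.1 s| < eta / 8.
  by apply: (AB (q, d)).
by move: h1 h2; rewrite ler_norml !ltr_norml; lra.
Unshelve. all: by end_near. Qed.

Lemma fstar_modulus : \forall d \near 0^'+, forall t, t0 <= t <= t1 ->
  forall s, t0 <= s <= t1 -> `|s - t| <= d -> `|fs s - fs t| <= eta / 4.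
Proof.
suff : \forall d \near 0^'+, forall t, `[t0, t1]%classic t ->
    forall s, t0 <= s <= t1 -> `|s - t| <= d -> `|fs s - fs t| <= eta / 4.
  by apply: filterS => d dE t tI; apply: dE; rewrite /= in_itv.
apply: compact_near_within; first exact: segment_compact.
move=> t; rewrite /= in_itv/= => tI; have e8 : 0 < eta / 8 by rewrite divr_gt0.
have /nbhs_ballP[r /= r0 rE] :=
  fstar_continuous fh_smooth h_LICQ a_ge0 V_basin a_lt_t0 t1_lt_b tI e8.
near=> q d; rewrite in_itv/= => qI s sI sd.
have d2 : d < r / 2 by near: d; apply: nbhs_right_lt; rewrite divr_gt0.
have q2 : `|t - q| < r / 2.
  by near: q; have /cvgrPdist_lt := @cvg_id _ (nbhs t); apply; rewrite divr_gt0.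
have h1 : `|fs q - fs t| < eta / 8.
  by apply: rE => //; rewrite /ball/= (lt_trans q2)//; lra.
have h2 : `|fs s - fs t| < eta / 8.
  apply: rE => //; rewrite /ball/=; have := ler_distD q t s;
    rewrite (distrC q s).
  by lra.
by move: h1 h2; rewrite ler_norml !ltr_norml; lra.
Unshelve. all: by end_near. Qed.

Lemma excess_le0 : exists2 alpha_bar, 0 < alpha_bar & forall alpha,
  0 < alpha <= alpha_bar -> forall x tau, t0 <= tau <= t1 ->
  velocity_near_K f h V t0 t1 alpha x ->
  (forall t, t0 <= t <= tau -> K (x t, t)) -> excess (x t0, t0) <= - eta ->
  forall t, t0 <= t <= tau -> excess (x t, t) <= 0.
Proof.
have N1 : 0 < N + 1 by rewrite ltr_wpDl.
near (0 : R)^'+ => d; have d0 : 0 < d by near: d; exact: nbhs_right_gt.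
have d_descent : forall p, K p -> - eta < excess p < 0 ->
    forall s, `|s - p.2| <= d -> d <= ((grad f p.1 s)^T *m pgrad f h p.1 p.2) 0
      0.
  by near: d; exact: descent_rate.
have d_drift : forall p, K p -> forall s, `|s - p.2| <= d ->
    d * ((grad f p.1 s)^T *m drift h p.1 p.2) 0 0 <= 1.
  by near: d; exact: drift_rate.
have d_f : forall p, K p -> forall s, `|s - p.2| <= d ->
    `|f p.1 s - f p.1 p.2| <= eta / 4 by near: d; exact: f_time_modulus.
have d_fs : forall t, t0 <= t <= t1 -> forall s, t0 <= s <= t1 -> `|s - t| <= d
  ->
    `|fs s - fs t| <= eta / 4 by near: d; exact: fstar_modulus.
have d_l : N * d <= eta / 4.
  apply: (@le_trans _ _ ((N + 1) * d));
    first by rewrite ler_wpM2r ?(ltW d0)// lerDl.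
  rewrite -ler_pdivlMl//; near: d; apply: nbhs_right_le.
  by rewrite mulr_gt0 ?invr_gt0// divr_gt0.
(* With this bound on [alpha], [f (x s) s1] has slope at most [- eta / d] for
   [s] in the band within time [d] of the entry time [s1]. *)
exists (d ^+ 2 / (1 + eta)) => [|alpha /andP[alpha0 alphaE] x tau tauI xE xK
  x0].
  by rewrite divr_gt0 ?exprn_gt0// addr_gt0.
have rateE : d^-1 + eta / d <= alpha^-1 * d.
  have : (1 + eta) / d ^+ 2 <= alpha^-1.
    rewrite -[leLHS]invrK lef_pV2 ?posrE// ?invr_gt0 ?divr_gt0 ?exprn_gt0
      ?addr_gt0//.
    by rewrite invf_div.
  rewrite -(ler_pM2r d0); apply: le_trans; rewrite le_eqVlt; apply/orP; left.
  by apply/eqP; field; rewrite gt_eqF.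
move=> t tI; rewrite leNgt; apply/negP => ext.
have KI s : t0 <= s <= t -> K (x s, s).
  by move=> /andP[t0s st]; apply: xK; rewrite t0s (le_trans st)//;
    case/andP: tI.
have exc : continuous_between t0 t (fun s => excess (x s, s)).
  move=> s sI e e0; have Ks := KI s sI; have [xc _] := xE s Ks.
  have [xct _] := cvg_graph xc.
  have enear := xct _ (excess_continuous Ks e0).
  near=> s' => s'I.
  have : K (x s', s') -> `|excess (x s', s') - excess (x s, s)| < e.
    by near: s'; exact: enear.
  by apply; exact: KI.
have t0t : t0 <= t by case/andP: tI.
have eta_lt0 : - eta < 0 by rewrite oppr_lt0.
(* Isolates one upward passage through the band, entered at [s1] and left at [s2]. *)
have [s1 [s2 [t0s1 s12 s2t ex1 [ex2 band]]]] :=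
  crossing t0t eta_lt0 exc x0 (ltW ext).
pose s' := Num.min s2 (s1 + d).
have s's1 : s1 < s' by rewrite lt_min s12 ltrDl.
have s'd : s' - s1 <= d by rewrite lerBlDl ge_min lexx orbT.
have s's2 : s' <= s2 by rewrite ge_min lexx.
have s1I : t0 <= s1 <= t by rewrite t0s1 (le_trans (ltW s12) s2t).
have s'I : t0 <= s' <= t by rewrite (le_trans t0s1 (ltW s's1)) (le_trans s's2).
have tt1 : t <= t1 by move: (tI) (tauI); lra_core.
have It1 s : t0 <= s <= t -> t0 <= s <= t1 by move=> /andP[-> /le_trans->].
pose u s := f (x s) s1.
pose du s := 'D_(velocity f h alpha (x s) s) (f^~ s1) (x s).
have s1_ge0 := ltW (time_gt0 a_ge0 a_lt_t0 t1_lt_b (It1 _ s1I)).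
have uE s : s1 <= s <= s' -> is_derive s 1 u (du s).
  move=> /andP[s1s ss']; have sI : t0 <= s <= t.
    by rewrite (le_trans t0s1 s1s) (le_trans ss')//; case/andP: s'I.
  apply: (@is_derive1_comp_diff _ _ _ (f^~ s1));
    first exact: (differentiable_f fh_smooth).
  by have [_ /nbhs_singleton] := xE s (KI s sI); apply; exact: It1.
have uc : {within `[s1, s'], continuous u}.
  by apply: derivable_within_continuous => s; rewrite in_itv => /uE[].
have [c cI u_mvt] := MVT s's1 (fun s sI => uE s (subset_itv_oo_cc sI)) uc.
have cI' : s1 < c < s' by move: cI; rewrite in_itv.
have cs1 : `|s1 - c| <= d.
  by rewrite ler0_norm; move: (cI') (s'd); lra_core.
have cI2 : t0 <= c <= t by move: (cI') (s1I) (s'I); lra_core.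
have Kc := KI c cI2.
have bandc : - eta < excess (x c, c) < 0.
  by apply: band; move: (cI') (s's2); lra_core.
have duc : du c <= - (eta / d).
  pose r := ((grad f (x c) s1)^T *m pgrad f h (x c) c) 0 0.
  pose q := ((grad f (x c) s1)^T *m drift h (x c) c) 0 0.
  have -> : du c = - (alpha^-1 * r) + q.
    apply: etrans (mulmx_velocity f h alpha (x c) c (grad f (x c) s1)).
    by apply: derive_grad; exact: (differentiable_f fh_smooth).
  have dr : d <= r := d_descent _ Kc bandc s1 cs1.
  have dq : d * q <= 1 := d_drift _ Kc s1 cs1.
  have alphaV : 0 <= alpha^-1 by rewrite invr_ge0 ltW.
  have h1 : alpha^-1 * d <= alpha^-1 * r := ler_wpM2l alphaV dr.
  have h2 : q <= d^-1 by rewrite -div1r ler_pdivlMr// mulrC.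
  by move: (h1) (h2) (rateE); lra_core.
have hu : u s' - u s1 <= - (eta / d * (s' - s1)).
  by rewrite u_mvt -mulNr ler_wpM2r// subr_ge0 ltW.
have s1s'd : `|s1 - s'| <= d by rewrite distrC ger0_norm ?subr_ge0 ?(ltW s's1).
have hf := d_f _ (KI s' s'I) s1 s1s'd.
have hfs := d_fs _ (It1 _ s1I) _ (It1 _ s'I).
rewrite distrC in s1s'd; have {}hfs := hfs s1s'd.
have hl : `|l s' - l s1| <= eta / 4.
  by apply: le_trans (l_lipschitz _ _) _; apply: le_trans d_l;
    rewrite ler_wpM2l.
(* Unfreezing [f] and moving [fs] and [l] from [s1] to [s'] cost [eta / 4] each, so [- eta / 4]
   remains of the initial [- eta]. *)
have key : excess (x s', s') <= - eta / 4 - eta / d * (s' - s1).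
  move: (hu) (hf) (hfs) (hl) (ex1); rewrite /u /excess/= !ler_norml; lra_core.
(* Either the top would be reached within time [d] with a negative excess, or after time [d] the
   excess would be below the band that has not been left yet. *)
have [s2d|ds2] := leP s2 (s1 + d).
  have s'E : s' = s2 by rewrite /s' min_l.
  have : 0 <= eta / d * (s' - s1) by rewrite mulr_ge0 ?divr_ge0 ?subr_ge0// ltW.
  by move: (key) (ex2) (eta_gt0); rewrite s'E; lra_core.
have s'E : s' = s1 + d by rewrite /s' min_r// ltW.
have : eta / d * (s' - s1) = eta by rewrite s'E addrAC subrr add0r divfK//
  gt_eqF.
have /andP[+ _] : - eta < excess (x s', s') < 0.
  by apply: band; rewrite s's1/= s'E.
by move: (key) (eta_gt0); lra_core.
Unshelve. all: by end_near. Qed.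

End Energy.

(** * The level function and the invariant region *)

Lemma max_lipschitz (R : realDomainType) (u v w : R) :
  `|Num.max u v - Num.max u w| <= `|v - w|.
Proof.
have := ler_norm (v - w); have := ler_norm (w - v); rewrite (distrC w v).
have := normr_ge0 (v - w); rewrite ler_norml /Num.max.
move: `|v - w| => k; case: (ltP u v) => ?; case: (ltP u w) => ? *.
all: by apply/andP; split; lra.
Qed.

Section Level.
Context {R : realType} {n m : nat}.
Variables (f : 'rV[R]_n -> R -> R) (h : 'rV[R]_n -> R -> 'rV[R]_m).
Hypotheses (fh_smooth : smoothness f h) (h_LICQ : LICQ h).
Variables (a b : R) (V : set (R * 'rV[R]_n)).
Hypotheses (a_ge0 : 0 <= a) (V_basin : contracting_basin f h V a b).
Variables (t0 t1 : R).
Hypotheses (a_lt_t0 : a < t0) (t0_le_t1 : t0 <= t1) (t1_lt_b : t1 < b).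

Local Notation K := (Kgraph h V t0 t1).
Local Notation fs := (fstar f h V).
Local Notation gap p := (f p.1 p.2 - fs p.2).

Lemma slice_boundaryE (t : R) x : t0 <= t <= t1 ->
  (slice_boundary V t `&` feasible_set h t) x <-> Kset h V t x /\ ~ V (t, x).
Proof.
move=> tI; have tab := time_itv a_lt_t0 t1_lt_b tI.
split=> [[[clx nix] hx]|[/(KsetE V_basin _ tab)[clx hx] nV]].
  split; first exact/(KsetE V_basin _ tab).
  move=> Vx; apply: nix.
  have [[A B] [/= tA xB] AB] : nbhs (t, x) V.
    by apply: open_nbhs_nbhs; split=> //; exact: basin_openV V_basin.
  apply: filterS xB => y By; rewrite /xsection/= inE; apply: (AB (t, y)).
  by split=> //=; exact: nbhs_singleton.
split=> //; split=> // /interior_subset; rewrite /xsection/= inE; exact: nV.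
Qed.

Lemma gap_near p e : K p -> 0 < e ->
  \forall q \near p, K q -> `|gap q - gap p| < e.
Proof.
move=> Kp e0.
have := excess_continuous fh_smooth h_LICQ a_ge0 V_basin a_lt_t0 t1_lt_b
  (lexx 0) (l := fun=> 0) (fun s t => ltac:(by rewrite subrr normr0 mul0r)) Kp
    e0.
apply: filterS => q; rewrite /excess !subr0; exact.
Qed.

(** As [V] is open, points of [V] have no boundary points nearby, so compactness arguments about the
    boundary part can run over all of [K]. *)
Lemma boundary_near p (P : R -> 'rV[R]_n * R -> Prop) : K p ->
  (~ V (p.2, p.1) -> \forall q \near p & d \near 0^'+, K q -> P d q) ->
  \forall q \near p & d \near 0^'+, K q -> ~ V (q.2, q.1) -> P d q.
Proof.
move=> Kp pP; have [Vp|/pP] := pselect (V (p.2, p.1)); last first.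
  by apply: filterS => -[q d] /= qd Kq _; exact: qd.
have swapc : (q.2, q.1) @[q --> p] --> (p.2, p.1).
  case: p {Kp pP Vp} => x t.
  exact: (cvg_pair (G := nbhs t) (H := nbhs x) cvg_snd cvg_fst).
have Vnear : \forall q \near p, V (q.2, q.1).
  by apply: swapc; apply: open_nbhs_nbhs; split=> //;
    exact: basin_openV V_basin.
near=> q d => _.
have Vq : V (q.2, q.1) by near: q; exact: Vnear.
by move=> /(_ Vq).
Unshelve. all: by end_near. Qed.

Lemma gap_gt0 p : K p -> ~ V (p.2, p.1) -> 0 < gap p.
Proof.
move=> Kp nV; rewrite ltNge subr_le0; apply/negP => fp; apply: nV.
have [] := (Kstar_critical V_basin a_lt_t0 t1_lt_b p.1 Kp.1).1 => //.
exact: (fstar_ge_Kstar fh_smooth a_ge0 V_basin a_lt_t0 t1_lt_b Kp.1 Kp.2 fp).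
Qed.

Lemma gap_boundary : \forall d \near 0^'+, forall p, K p -> ~ V (p.2, p.1) ->
  d <= gap p.
Proof.
apply: compact_near_within.
  exact: (Kgraph_compact fh_smooth a_ge0 V_basin a_lt_t0 t1_lt_b).
move=> p Kp; apply: boundary_near => // nV.
have g2 : 0 < gap p / 2 by rewrite divr_gt0// gap_gt0.
have gnear := gap_near Kp g2.
near=> q d.
have gq : K q -> `|gap q - gap p| < gap p / 2 by near: q; exact: gnear.
have dg : d <= gap p / 2 by near: d; exact: nbhs_right_le.
move=> /gq; move: dg; move: (gap q) (gap p) => u v dv.
by rewrite ltr_norml => /andP[+ _] /=; move: dv; lra.
Unshelve. all: by end_near. Qed.

(** When there are boundary points, [L] is [fhat - fs] at time [t0], half of the least boundary gap;
    as that gap is positive, [L] lies strictly below it. *)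
Lemma initial_level : exists L, (forall x, Khat f h V t0 x -> gap (x, t0) <= L)
  /\
  (forall x, K (x, t0) -> ~ V (t0, x) -> L < gap (x, t0)).
Proof.
have t0I : t0 <= t0 <= t1 by rewrite lexx.
(* Without boundary points [fhat] is infinite and [Khat] is all of [K], so a bound of the gap over
   [K] serves. *)
have [[x1 [x1K nVx1]]|noB] :=
    pselect (exists x, Kset h V t0 x /\ ~ V (t0, x)); last first.
  have [C C0 CE] : exists2 C, 0 < C & forall p, K p -> `|f p.1 p.2| <= C.
    apply: compact_bounded_at.
      exact: (Kgraph_compact fh_smooth a_ge0 V_basin a_lt_t0 t1_lt_b).
    move=> [x t] Kp.
    exact: (continuous_f fh_smooth (time_gt0 a_ge0 a_lt_t0 t1_lt_b Kp.1)).
  exists (C - fs t0); split=> x [Kx].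
    by move=> _; rewrite lerD2r (le_trans (ler_norm _))//; apply: (CE (x, t0)).
  by move=> Kx2 nV; exfalso; apply: noB; exists x.
near (0 : R)^'+ => d; have d0 : 0 < d by near: d; exact: nbhs_right_gt.
have dE : forall p, K p -> ~ V (p.2, p.1) -> d <= gap p by near: d;
  exact: gap_boundary.
set S := [set (f x t0)%:E | x in slice_boundary V t0 `&` feasible_set h t0].
have S_lb : lbound S (fs t0 + d)%:E.
  move=> _ [x /(slice_boundaryE _ t0I)[Kx nV] <-];
    rewrite lee_fin addrC -lerBrDr.
  by apply: (dE (x, t0)).
have S_le x : Kset h V t0 x -> ~ V (t0, x) -> (ereal_inf S <= (f x t0)%:E)%E.
  by move=> Kx nV; apply: ereal_inf_lbound; exists x => //;
    apply/slice_boundaryE.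
have S_ge : ((fs t0 + d)%:E <= ereal_inf S)%E by apply: le_ereal_inf_tmp.
have [r rE] : exists r, ereal_inf S = r%:E.
  move: S_ge (S_le _ x1K nVx1); case: (ereal_inf S) => [r| |]//; by exists r.
move: S_ge S_le; rewrite rE lee_fin => rd S_le.
exists ((r - fs t0) / 2); split=> x [Kx].
  by rewrite /fhat -/S rE -EFinD -EFinM lee_fin /=; lra.
move=> Kx2 nV; have := S_le x Kx2 nV; rewrite lee_fin /=; lra.
Unshelve. all: by end_near. Qed.

(** [d] is both the length of the initial period and the margin over [L]. Points at times after [t0]
    fall outside the period once [d] is small; at [t0] the gap is continuous. *)
Lemma gap_initial_boundary (L : R) :
  (forall x, K (x, t0) -> ~ V (t0, x) -> L < gap (x, t0)) ->
  \forall d \near 0^'+, forall p, K p -> ~ V (p.2, p.1) ->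
    p.2 <= t0 + d -> L + d < gap p.
Proof.
move=> LE; apply: compact_near_within.
  exact: (Kgraph_compact fh_smooth a_ge0 V_basin a_lt_t0 t1_lt_b).
move=> p Kp; apply: boundary_near => // nV.
have [t0p|pt0] := ltP t0 p.2.
  have p2 : t0 + (p.2 - t0) / 2 < p.2 by lra.
  have snear : \forall q \near p, t0 + (p.2 - t0) / 2 < q.2.
    case: p {Kp nV t0p} p2 => x t /= tt.
    exact: (near_snd (P := [set s | t0 + (t - t0) / 2 < s]) x (lt_nbhsr tt)).
  near=> q d.
  have q2 : t0 + (p.2 - t0) / 2 < q.2 by near: q; exact: snear.
  have d2 : d <= (p.2 - t0) / 2.
    by near: d; apply: nbhs_right_le; rewrite divr_gt0// subr_gt0.
  by move=> _ /= qd; exfalso; move: q2 d2 qd; lra.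
have pE : p.2 = t0 by apply/eqP; rewrite eq_le pt0; case/andP: Kp.1.
have Lp : L < gap p.
  by case: p pE Kp nV {pt0} => x t /= ->; exact: LE.
have g2 : 0 < (gap p - L) / 2 by rewrite divr_gt0// subr_gt0.
have gnear := gap_near Kp g2.
near=> q d.
have gq : K q -> `|gap q - gap p| < (gap p - L) / 2 by near: q; exact: gnear.
have dg : d <= (gap p - L) / 2 by near: d; exact: nbhs_right_le.
move=> /gq; move: dg; move: (gap q) (gap p) => u v dv.
by rewrite ltr_norml => /andP[+ _] _ /=; move: dv; lra.
Unshelve. all: by end_near. Qed.

Lemma level_function (eps nu : R) : 0 < eps -> 0 < nu ->
  exists l : R -> R, exists N eta : R,
  [/\ 0 <= N, (forall s t, `|l s - l t| <= N * `|s - t|), 0 < eta,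
      (forall t, eta < l t) & [/\
      (forall p, K p -> ~ V (p.2, p.1) -> l p.2 < gap p),
      (forall x, Khat f h V t0 x -> gap (x, t0) - l t0 <= - eta) &
      (forall t, t0 + nu <= t -> l t <= eps)]].
Proof.
move=> eps0 nu0.
have [L [LK LB]] := initial_level.
near (0 : R)^'+ => d; have d0 : 0 < d by near: d; exact: nbhs_right_gt.
have d_gap : forall p, K p -> ~ V (p.2, p.1) -> d <= gap p by near: d;
  exact: gap_boundary.
have d_L : forall p, K p -> ~ V (p.2, p.1) -> p.2 <= t0 + d -> L + d < gap p.
  by near: d; exact: gap_initial_boundary.
(* The floor [e] of the level is at most [eps] for tracking, and at most [d / 2] to stay under the
   boundary gap, which is at least [d]. The width [eta] is below the floor and fits in the initial
   margin [d]. *)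
pose e := Num.min eps (d / 2); pose eta := Num.min (e / 2) d.
(* Steep enough for the ramp from [L + d] to be nonpositive after time [d], when the control near
   [t0] ends, and after time [nu]. *)
pose N := `|L + d| * (d^-1 + nu^-1).
pose l t := Num.max e (L + d - N * (t - t0)).
have e0 : 0 < e by rewrite lt_min eps0 divr_gt0.
have e_eps : e <= eps by rewrite ge_min lexx.
have e_d : e <= d / 2 by rewrite ge_min lexx orbT.
have eta0 : 0 < eta by rewrite lt_min d0 divr_gt0.
have eta_e : eta <= e / 2 by rewrite ge_min lexx.
have eta_d : eta <= d by rewrite ge_min lexx orbT.
have N0 : 0 <= N by rewrite mulr_ge0// addr_ge0// invr_ge0 ltW.
have Nlarge r t : (r = d) \/ (r = nu) -> t0 + r <= t -> L + d - N * (t - t0) <=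
  0.
  move=> rE tr; have r0 : 0 < r by case: rE => ->.
  have NE : `|L + d| <= N * r.
    have rV : r^-1 <= d^-1 + nu^-1.
      by case: rE => ->; rewrite ?lerDl ?lerDr invr_ge0 ltW.
    rewrite -[leLHS]mulr1 -(mulVf (lt0r_neq0 r0)) mulrA ler_wpM2r ?(ltW r0)//.
    by rewrite ler_wpM2l.
  have : N * r <= N * (t - t0) by rewrite ler_wpM2l// lerBrDl.
  by have := ler_norm (L + d); move: NE; lra.
have lN s t : `|l s - l t| <= N * `|s - t|.
  have maxl (u v w : R) : `|Num.max u v - Num.max u w| <= `|v - w|.
    exact: max_lipschitz.
  apply: le_trans (maxl _ _ _) _.
  have -> : L + d - N * (s - t0) - (L + d - N * (t - t0)) = N * (t - s) by ring.
  by rewrite normrM (ger0_norm N0) distrC.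
exists l, N, eta; split => //.
  by move=> t; rewrite lt_max; apply/orP; left; move: eta_e e0; lra.
split.
- move=> p Kp nV; rewrite gt_max; apply/andP; split.
    by apply: lt_le_trans (d_gap p Kp nV); move: e_d d0; lra.
  have t0p : t0 <= p.2 by case/andP: Kp.1.
  have [pd|/ltW dp] := leP p.2 (t0 + d).
    apply: le_lt_trans (d_L p Kp nV pd); rewrite gerBl mulr_ge0// subr_ge0//.
  by apply: le_lt_trans (Nlarge d _ (or_introl erefl) dp) _; exact: gap_gt0.
- move=> x /LK xL; have : L + d <= l t0.
    by rewrite le_max subrr mulr0 subr0 lexx orbT.
  by move: (l t0) xL eta_d => lt0 /=; lra.
- move=> t tnu; rewrite ge_max e_eps/=.
  exact: le_trans (Nlarge nu _ (or_intror erefl) tnu) (ltW eps0).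
Unshelve. all: by end_near. Qed.

(** Continuation: the supremum [tau] of the times up to which the curve stays in the closed graph is
    attained. The level bound keeps the curve in [V] at [tau], so [Kgraph_persist] would prolong it
    if [tau < t1]. The bound is assumed only while the curve has stayed in the graph, as
    [excess_le0] provides it. *)
Lemma Kgraph_invariant (l : R -> R) (alpha : R) (x : R -> 'rV[R]_n) :
  (forall p, K p -> ~ V (p.2, p.1) -> l p.2 < gap p) ->
  (forall t : R, t0 <= t <= t1 -> {for t, continuous x}) ->
  velocity_near_K f h V t0 t1 alpha x -> K (x t0, t0) ->
  (forall tau, t0 <= tau <= t1 -> (forall t, t0 <= t <= tau -> K (x t, t)) ->
    gap (x tau, tau) <= l tau) ->
  forall t, t0 <= t <= t1 -> K (x t, t) /\ gap (x t, t) <= l t.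
Proof.
move=> lB xc xK Kt0 gapl.
pose S := [set tau | t0 <= tau <= t1 /\ forall t, t0 <= t <= tau -> K (x t, t)].
have St0 : S t0.
  split=> [|t]; first by rewrite lexx.
  by rewrite -eq_le => /eqP <-.
have Sub : ubound S t1 by move=> s [/andP[]].
have supS : has_sup S by split; [exists t0 | exists t1].
set tau := sup S.
have tauI : t0 <= tau <= t1.
  by rewrite ub_le_sup//=; [rewrite ge_sup//; exists t0 | exists t1].
have Kbefore t : t0 <= t -> t < tau -> K (x t, t).
  move=> t0t tt; have [s [_ sK] ts] := sup_adherent (ltac:(by rewrite subr_gt0)
    : 0 < tau - t) supS.
  by apply: sK; rewrite t0t ltW//; move: ts; rewrite opprB addrCA subrr addr0.
have Kcl : closed K.
  apply: compact_closed; first exact: norm_hausdorff.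
  exact: (Kgraph_compact fh_smooth a_ge0 V_basin a_lt_t0 t1_lt_b).
have Ktau : K (x tau, tau).
  apply: contrapT => nK; have [xct _] := cvg_graph (xc tau tauI).
  have nKnear : nbhs (x tau, tau) (~` K).
    by apply: open_nbhs_nbhs; split; [exact: closed_openC | exact: nK].
  have /nbhs_ballP[r /= r0 rE] := xct _ nKnear.
  have [t0tau|tau0] := ltP t0 tau; last first.
    have E : tau = t0 by apply/eqP; rewrite eq_le tau0; case/andP: tauI.
    by apply: nK; rewrite E.
  pose s := Num.max t0 (tau - r / 2).
  have st : s < tau by rewrite gt_max t0tau ltrBlDr ltrDl divr_gt0.
  have t0s : t0 <= s by rewrite le_max lexx.
  apply: (rE s); last exact: Kbefore.
  have : tau - r / 2 <= s by rewrite le_max lexx orbT.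
  rewrite /ball/= ger0_norm; last by rewrite subr_ge0 ltW.
  by move: r0; clear - fh_smooth h_LICQ a_ge0 V_basin a_lt_t0 t0_le_t1 t1_lt_b;
    lra.
have Kall t : t0 <= t <= tau -> K (x t, t).
  move=> /andP[t0t]; rewrite le_eqVlt => /orP[/eqP ->//|].
  exact: Kbefore.
have tauE : tau = t1.
  apply/eqP; rewrite eq_le; case/andP: (tauI) => t0tau -> /=.
  rewrite leNgt; apply/negP => tau1.
  have Vtau : V (tau, x tau).
    apply: contrapT => nV; have := lB _ Ktau nV.
    by rewrite ltNge gapl.
  have Kper := Kgraph_persist fh_smooth h_LICQ a_ge0 V_basin a_lt_t0 t1_lt_b xK
    Ktau Vtau.
  have /nbhs_ballP[r /= r0 rE] := Kper.
  pose s := Num.min t1 (tau + r / 2).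
  have ts : tau < s by rewrite lt_min tau1 ltrDl divr_gt0.
  have st1 : s <= t1 by rewrite ge_min lexx.
  have sr : s <= tau + r / 2 by rewrite ge_min lexx orbT.
  suff : S s by move=> /(ub_le_sup (ex_intro _ _ Sub)); rewrite leNgt ts.
  split; first by rewrite st1 andbT (le_trans t0tau (ltW ts)).
  move=> t /andP[t0t tS]; have [ttau|taut] := leP t tau; first by apply: Kall;
    rewrite t0t.
  apply: rE; last by rewrite t0t (le_trans tS).
  by rewrite /ball/= ler0_norm ?subr_le0 ?(ltW taut)//; move: r0 tS sr; lra.
move=> t tI; have tI' : t0 <= t <= tau by rewrite tauE.
split; first exact: Kall.
apply: (gapl t tI) => s /andP[t0s st]; apply: Kall.
by rewrite t0s (le_trans st)//; case/andP: tI'.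
Qed.

Lemma multiplier_bounded alpha : exists2 M, 0 < M & forall k p, K p ->
  `|multiplier f h alpha p.1 p.2 k 0| <= M.
Proof.
apply: uniform_constant => [k C C' CC' CE p Kp|k];
  first exact: le_trans (CE p Kp) CC'.
apply: (compact_bounded_at (q := fun p => multiplier f h alpha p.1 p.2 k 0)).
  exact: (Kgraph_compact fh_smooth a_ge0 V_basin a_lt_t0 t1_lt_b).
move=> [x t] Kp; have tpos := time_gt0 a_ge0 a_lt_t0 t1_lt_b Kp.1.
have Jp := Kgraph_row_free h_LICQ a_ge0 V_basin a_lt_t0 t1_lt_b Kp.
exact: ((cvg_mxP _ _).1 (cvg_multiplier fh_smooth tpos Jp (alpha := alpha)) k
  0).
Qed.

Lemma Khat_Kgraph x : Khat f h V t0 x -> K (x, t0).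
Proof. by case=> Kx _; split; rewrite /= ?lexx. Qed.

End Level.

(** * From invariance to existence, uniqueness and tracking *)

Unset Implicit Arguments.

Theorem theorem21 (R : realType) (n m : nat)
    (f : 'rV[R]_n -> R -> R) (h : 'rV[R]_n -> R -> 'rV[R]_m)
    (f_h_smooth : smoothness f h)
    (h_feasible : feasibility h)
    (h_LICQ : LICQ h)
    (a b : R) (a_ge0 : 0 <= a)
    (V : set (R * 'rV[R]_n))
    (V_basin : contracting_basin f h V a b)
    (t0 t1 : R) (a_lt_t0 : a < t0) (t0_le_t1 : t0 <= t1) (t1_lt_b : t1 < b) :
  forall eps nu : R, 0 < eps -> 0 < nu ->
  exists2 alpha_bar : R, 0 < alpha_bar &
    forall alpha : R, 0 < alpha <= alpha_bar ->
      allows_tracking f h V alpha t0 t1 eps nu.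
Proof.
move=> eps nu eps0 nu0.
have [l [N [eta [N0 lN eta0 eta_l [l_bd l_init l_final]]]]] :=
  level_function f_h_smooth h_LICQ a_ge0 V_basin a_lt_t0 t0_le_t1 t1_lt_b eps0
    nu0.
have [abar abar0 ex_le0] := excess_le0 f_h_smooth h_LICQ a_ge0 V_basin a_lt_t0
  t1_lt_b
  N0 lN eta0 eta_l l_bd.
exists abar => // alpha alphaI.
have t0I : t0 <= t0 <= t1 by rewrite lexx.
(* Stated for curves rather than solutions: it serves for the cut-off flow, not yet known to be a
   solution, and for every given solution. *)
have invariant x0 x : Khat f h V t0 x0 -> x t0 = x0 ->
    (forall t : R, t0 <= t <= t1 -> {for t, continuous x}) ->
    velocity_near_K f h V t0 t1 alpha x ->
    forall t, t0 <= t <= t1 -> Kgraph h V t0 t1 (x t, t) /\ f (x t) t - fstar f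
      h V t <= l t.
  move=> x0K xt0 xc xK t tI.
  have Kt0 : Kgraph h V t0 t1 (x t0, t0) by rewrite xt0; exact: Khat_Kgraph x0K.
  apply: (Kgraph_invariant f_h_smooth h_LICQ a_ge0 V_basin a_lt_t0 t0_le_t1
    t1_lt_b l_bd xc xK Kt0 _ tI).
  move=> tau tauI tauK; rewrite -subr_le0.
  apply: (ex_le0 alpha alphaI x tau tauI xK tauK); last first.
    by rewrite lexx andbT; case/andP: tauI.
  by rewrite /excess/= xt0; exact: l_init.
have sol_near x0 x : solution f h alpha t0 t1 x0 x ->
    (forall t : R, t0 <= t <= t1 -> {for t, continuous x}) /\
    velocity_near_K f h V t0 t1 alpha x.
  move=> [_ xS]; have xc (t : R) : t0 <= t <= t1 -> {for t, continuous x}.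
    by move=> /xS[_ xt]; exact: is_derive1_continuous xt.
  split=> // t [tI _]; split; first exact: xc.
  by near=> s => /xS[].
have sol_invariant x0 x : Khat f h V t0 x0 -> solution f h alpha t0 t1 x0 x ->
    forall t, t0 <= t <= t1 -> Kgraph h V t0 t1 (x t, t) /\ f (x t) t - fstar f
      h V t <= l t.
  move=> x0K xS; have [xc xK] := sol_near _ _ xS.
  by apply: invariant x0K _ xc xK; case: xS.
split=> [x0 x0K|x0 x x0K xS t tI|x0 x x0K xS t /andP[tnu tt1]].
- have [x /= xt0 [xd xK]] := cutoff_flow f_h_smooth h_LICQ a_ge0 V_basin
  a_lt_t0 t1_lt_b
    alpha (Khat_Kgraph t0_le_t1 x0K).
  have xc (t : R) : t0 <= t <= t1 -> {for t, continuous x}.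
    by move=> _; apply/differentiable_continuous/derivable1_diffP; exact: xd.
  have xKt := invariant x0 x x0K xt0 xc xK.
  have xS : solution f h alpha t0 t1 x0 x.
    split=> // t tI; have [Kt _] := xKt t tI; split.
      exact: (Kgraph_row_free h_LICQ a_ge0 V_basin a_lt_t0 t1_lt_b Kt).
    by have [_ /nbhs_singleton] := xK t Kt; apply.
  exists x => // y yS.
  have [B B0 BE] := Kgraph_bounded V_basin a_lt_t0 t1_lt_b.
  have [M M0 ME] := multiplier_bounded f_h_smooth h_LICQ a_ge0 V_basin a_lt_t0
    t1_lt_b alpha.
  have bounded z : solution f h alpha t0 t1 x0 z -> bounded_solution f h alpha
    t0 t1 B M z.
    move=> zS t tI; have [Kz _] := sol_invariant x0 z x0K zS t tI; split.
    + exact: (BE _ Kz).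
    + have [_ Kz2] := Kz.
      by have [_ hz] := (KsetE V_basin _ (time_itv a_lt_t0 t1_lt_b tI)).1 Kz2.
    + by move=> k; exact: (ME k _ Kz).
    + by case: zS => _ /(_ t tI)[].
  apply: (bounded_solution_unique f_h_smooth (time_gt0 a_ge0 a_lt_t0 t1_lt_b
    t0I) (bounded y yS) (bounded x xS)).
  by rewrite xt0; case: yS.
- by have [[_ Kt] _] := sol_invariant x0 x x0K xS t tI.
- have tI : t0 <= t <= t1.
    by rewrite tt1 andbT (le_trans _ tnu)// lerDl ltW.
  by have [_ /le_trans] := sol_invariant x0 x x0K xS t tI; apply;
    exact: l_final.
Unshelve. all: by end_near. Qed.
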